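(* Let $\mathcal{S}$ be the W-glued diamond obtained by gluing the diamond $\mathcal{A}=\{a,b,c,d\}$ with W-class posets at $a$ with a minimal element of $\mathcal{W}_a$, at $b$ with a minimal element of $\mathcal{W}_b$, at $c$ with a minimal element of $\mathcal{W}_c$, and at $d$ with a maximal element of $\mathcal{W}_d$. Let $P_1\preceq P_2$ be a stochastically ordered pair of measures on $\mathcal{S}$ with common mass $p=P_1(S)=P_2(S)$. Let $\mathcal{W}$, $F_1\preceq F_2$, $(K,1)$ be the tree poset rooted at $d$, the distribution functions on it and the rooted plane tree of indices described in the context, let $\mu$ be a distribution function on $K$ interlaced with $F_1$ and $F_2$ (so $\mu(1)=p$), and let $X_{\mu,1},X_{\mu,2}:[0,p)\to\mathcal{W}$ be the corresponding recursive inverse transforms. Then there exists a modification $(\tilde X_{\mu,1},\tilde X_{\mu,2})$ of the pair $(X_{\mu,1},X_{\mu,2})$ such that $$\lambda(\{\omega:\tilde X_{\mu,i}(\omega)\in B\})=P_i(B),\quad i=1,2,$$ for every subset $B$ of $\mathcal{S}$, where $\lambda$ is Lebesgue measure on $[0,p)$, and $$\tilde X_{\mu,1}(\omega)\le\tilde X_{\mu,2}(\omega)\text{ in }\mathcal{S}\text{ for every }\omega\in[0,p).$$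
   Context: Posets. All posets are finite and connected. The diamond $\{a,b,c,d\}$ has $a<b<d$, $a<c<d$, $b,c$ incomparable. The Hasse diagram of a poset is the undirected graph of covering relations; a poset is acyclic if this graph has no cycle. A poset is in W-class if it is acyclic and has no induced subposet that is a bowtie ($\{e,f,g,h\}$ with $e,f<g,h$, $e,f$ incomparable, $g,h$ incomparable), a Y-poset ($e<f<g$, $f<h$, $g,h$ incomparable), or the dual of a Y-poset. Posets sharing exactly one element are glued there by taking the poset whose Hasse diagram is the union of the Hasse diagrams (covering directions kept). $W_b$ etc. is the underlying set of $\mathcal{W}_b$ etc. For finite nonnegative measures with the same total mass, $P\preceq P'$ means $P(U)\le P'(U)$ for every up-set $U$; distribution functions are ordered by $\preceq$ when the corresponding measures are. The poset $\mathcal{W}$ and measures. Let $q'=\max\{P_1(W_b),P_2(W_b)\}$, $q''=\max\{P_1(W_c),P_2(W_c)\}$. On the subposet $\hat{\mathcal{W}}^{(\eta_b)}$ of $\mathcal{S}$ induced on $\{d\}\cup W_b$ define $Q^{(\eta_b)}_1(b)=q'-P_1(W_b\setminus\{b\})$, $Q^{(\eta_b)}_1(d)=0$, $Q^{(\eta_b)}_1(y)=P_1(y)$ for $y\in W_b\setminus\{b\}$; $Q^{(\eta_b)}_2(d)=q'-P_2(W_b)$, $Q^{(\eta_b)}_2(y)=P_2(y)$ for $y\in W_b$. Define $Q^{(\eta_c)}_i$ on the subposet $\hat{\mathcal{W}}^{(\eta_c)}$ induced on $\{d\}\cup W_c$ in the same way with $b,q'$ replaced by $c,q''$. On the subposet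 $\mathcal{W}'$ induced on $W_a\cup W_d$ define $P'_1(a)=P_1(\{a\}\cup W_b\cup W_c)-q'-q''$, $P'_1(y)=P_1(y)$ for $y\ne a$; $P'_2(d)=P_2(\{d\}\cup W_b\cup W_c)-q'-q''$, $P'_2(y)=P_2(y)$ for $y\neq d$. Let $\mathcal{W}$ be the poset obtained by gluing $\hat{\mathcal{W}}^{(\eta_b)},\hat{\mathcal{W}}^{(\eta_c)},\mathcal{W}'$ at $d$; its Hasse diagram $W$ is a tree, rooted at $\tau=d$. For $x,y\in W$ write $x\le_\tau y$ if the path from $\tau$ to $x$ in $W$ contains the path from $\tau$ to $y$. The distribution function of a measure $R$ is $F(x)=R(\{z:z\le_\tau x\})$. Let $F^{(\eta_b)}_i,F^{(\eta_c)}_i,F'_i$ be the distribution functions (with root $d$) of $Q^{(\eta_b)}_i,Q^{(\eta_c)}_i,P'_i$, and let $F_i(y)=F^{(\eta_b)}_i(y)$ for $y\in W_b$, $F^{(\eta_c)}_i(y)$ for $y\in W_c$, $F'_i(y)$ for $y\in (W_a\cup W_d)\setminus\{d\}$, and $F_i(d)=p$. Index tree. Put $W^{(1)}=W$, $u^{(1)}_1=d$. Given an index $\kappa$ with rooted subtree $(W^{(\kappa)},u_1^{(\kappa)})$, let $\mathbf{u}^{(\kappa)}=(u_1^{(\kappa)},u_2^{(\kappa)},\dots,u_*^{(\kappa)})$ be the path descending from the root until the first vertex $u_*^{(\kappa)}$ having no successor (child) or more than one successor. If none, $C(\kappa)=\varnothing$. Otherwise the successors $u_1^{(\sigma_1)},\dots,u_1^{(\sigma_M)}$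 of $u_*^{(\kappa)}$ are indexed by a linearly ordered set $C(\kappa)=\{\sigma_1,\dots,\sigma_M\}$ of children of $\kappa$, and $W^{(\sigma_i)}$ is the component containing $u_1^{(\sigma_i)}$ after removing the vertices of $\mathbf{u}^{(\kappa)}$ from $W^{(\kappa)}$. Repeating this recursively gives the rooted plane tree $(K,1)$ of indices. At the root, $C(1)=\{\eta_b,\eta_c,\eta_a,\zeta_1,\dots,\zeta_M\}$ in this order, with $u_1^{(\eta_b)}=b$, $u_1^{(\eta_c)}=c$, $u_1^{(\eta_a)}=a$, and $u_1^{(\zeta_i)}$ the elements of $W_d$ covered by $d$. Interlacing. A distribution function on $K$ is $\mu:K\to[0,\infty)$ with $\mu(\kappa)\ge\mu(\kappa-):=\sum_{\sigma\in C(\kappa)}\mu(\sigma)$. It is interlaced with $F$ if $\mu(1)=F(\tau)$ and $\mu(\kappa-)\le F(u_*^{(\kappa)})\le F(u_1^{(\kappa)})\le\mu(\kappa)$ for all $\kappa\in K$. Recursive inverse transform. For $\kappa\neq1$ with parent $\hat\kappa$ let $\hat{\mathbf{u}}^{(\kappa)}=(u_*^{(\hat\kappa)},u_1^{(\kappa)},\dots,u_*^{(\kappa)})$, and let $\hat{\mathbf{u}}^{(1)}=\mathbf{u}^{(1)}$. Put $F_i^{(1)}=F_i$, and for $\kappa\ne1$, $F_i^{(\kappa)}(x)=F_i(x)$ for $x\in W^{(\kappa)}$, $F_i^{(\kappa)}(u_*^{(\hat\kappa)})=\mu(\kappa)$. Define $X^{(\kappa)}_{\mu,i}:[0,\mu(\kappa))\to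 W$ recursively: for $\omega\in[0,\mu(\kappa-))$, $X^{(\kappa)}_{\mu,i}(\omega)=X^{(\sigma_j)}_{\mu,i}\big(\omega-\sum_{l<j}\mu(\sigma_l)\big)$ if $\sum_{l<j}\mu(\sigma_l)\le\omega<\sum_{l\le j}\mu(\sigma_l)$; for $\omega\in[\mu(\kappa-),\mu(\kappa))$, $X^{(\kappa)}_{\mu,i}(\omega)$ is the $\le_\tau$-minimum of $\{x\in\hat{\mathbf{u}}^{(\kappa)}:\omega<F_i^{(\kappa)}(x)\}$. Set $X_{\mu,i}=X^{(1)}_{\mu,i}$. Modification. A modification of $(X_{\mu,1},X_{\mu,2})$ is a pair $(\tilde X_{\mu,1},\tilde X_{\mu,2})$ with $\tilde X_{\mu,2}=X_{\mu,2}$ and with $\tilde X_{\mu,1}$ obtained from $X_{\mu,1}$ by changing its value to $a$ on some measurable subset of $\{\omega:X_{\mu,1}(\omega)\in\{b,c\}\}$. *)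

(* Defs.v *)
From HB Require Import structures.
From mathcomp Require Import all_boot all_order all_algebra.
From mathcomp Require Import all_classical all_reals all_analysis.

Set Implicit Arguments.
Unset Strict Implicit.
Unset Printing Implicit Defensive.

Import Order.TTheory GRing.Theory Num.Theory.

(** * Rooted trees, presented by a symmetric edge relation and a root *)

Section RootedTree.
Variables (T : finType) (e : rel T) (tau : T).

Definition simple_path (x y : T) (p : seq T) : bool :=
  [&& path e x p, last x p == y & uniq (x :: p)].

(* In a tree simple paths exist and are unique, so quantifying the two paths
   existentially is harmless.  A vertex that is not connected to the root is
   not comparable with anything. *)
Definition tree_le (x y : T) : bool :=
  `[< exists p q : seq T,
        [/\ simple_path tau x p, simple_path tau y q
          & {subset tau :: q <= tau :: p}] >].

Definition successors (D : {set T}) (x : T) : {set T} :=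
  [set y in D | e x y && tree_le y x]%SET.

Definition acyclic_graph : Prop :=
  forall s : seq T, (2 < size s)%N -> uniq s -> ~~ cycle e s.

End RootedTree.

(** * Finite posets: induced subposets are given by their underlying sets *)

Section Posets.
Context {disp : Order.disp_t} {S : finPOrderType disp}.
Implicit Types (D U : {set S}) (x y z : S).
Local Open Scope order_scope.

(* [hasse D x y]: y covers x in the subposet induced on D. *)
Definition hasse D : rel S := fun x y =>
  [&& x \in D, y \in D, x < y & [forall z in D, ~~ ((x < z) && (z < y))]].

Definition undirected (r : rel S) : rel S := fun x y => r x y || r y x.

(* The union of the Hasse diagrams of several induced subposets, i.e. the
   Hasse diagram of the poset obtained by gluing them. *)
Definition glued_hasse (Ds : seq {set S}) : rel S := fun x y =>
  has (fun D => hasse D x y) Ds.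

Definition connected_poset D : Prop :=
  {in D &, forall x y, connect (undirected (hasse D)) x y}.

Definition acyclic_poset D : Prop := acyclic_graph (undirected (hasse D)).

Definition has_bowtie D : Prop :=
  exists e f g h : S, [/\ e \in D, f \in D, g \in D & h \in D] /\
    [/\ e < g, e < h, f < g & f < h] /\ (e >< f) /\ (g >< h).

Definition has_Y D : Prop :=
  exists e f g h : S, [/\ e \in D, f \in D, g \in D & h \in D] /\
    [/\ e < f, f < g, f < h & g >< h].

Definition has_dual_Y D : Prop :=
  exists e f g h : S, [/\ e \in D, f \in D, g \in D & h \in D] /\
    [/\ f < e, g < f, h < f & g >< h].

Definition W_class D : Prop :=
  [/\ connected_poset D, acyclic_poset D,
      ~ has_bowtie D, ~ has_Y D & ~ has_dual_Y D].

Definition minimal_in D x : Prop := x \in D /\ {in D, forall y, ~~ (y < x)}.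
Definition maximal_in D x : Prop := x \in D /\ {in D, forall y, ~~ (x < y)}.

Definition up_set U : Prop := forall x y, x \in U -> x <= y -> y \in U.

End Posets.

(** * W-glued diamonds *)

Record glue_data (S : finType) := GlueData {
  ga : S; gb : S; gc : S; gd : S;
  Wa : {set S}; Wb : {set S}; Wc : {set S}; Wd : {set S} }.

Section WGluedDiamond.
Context {disp : Order.disp_t} {S : finPOrderType disp}.
Variable G : glue_data S.
Local Open Scope order_scope.
Local Notation a := (ga G).
Local Notation b := (gb G).
Local Notation c := (gc G).
Local Notation d := (gd G).

Definition diamond : {set S} := [set a; b; c; d]%SET.

(* Up to isomorphism, a poset obtained by gluing is a poset S covered by the
   glued pieces (as induced subposets), whose Hasse diagram is the union of
   theirs. *)
Record W_glued_diamond : Prop := {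
  wgd_diamond : [/\ a < b, b < d, a < c, c < d & b >< c];
  wgd_W_class : [/\ W_class (Wa G), W_class (Wb G), W_class (Wc G)
                  & W_class (Wd G)];
  wgd_extremal : [/\ minimal_in (Wa G) a, minimal_in (Wb G) b,
                     minimal_in (Wc G) c & maximal_in (Wd G) d];
  wgd_shared : [/\ diamond :&: Wa G = [set a]%SET,
                   diamond :&: Wb G = [set b]%SET,
                   diamond :&: Wc G = [set c]%SET
                 & diamond :&: Wd G = [set d]%SET];
  wgd_disjoint : [/\ [disjoint Wa G & Wb G], [disjoint Wa G & Wc G]
                   & [disjoint Wa G & Wd G]] /\
                 [/\ [disjoint Wb G & Wc G], [disjoint Wb G & Wd G]
                   & [disjoint Wc G & Wd G]];
  wgd_cover : Wa G :|: Wb G :|: Wc G :|: Wd G = [set: S]%SET;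
  wgd_hasse : hasse [set: S]%SET =2
    glued_hasse [:: diamond; Wa G; Wb G; Wc G; Wd G] }.

Definition hatWb : {set S} := d |: Wb G.
Definition hatWc : {set S} := d |: Wc G.
Definition Wprime : {set S} := Wa G :|: Wd G.

(* The tree underlying the Hasse diagram of the poset glued from the three
   subposets above; its vertices are all the elements of S. *)
Definition W_tree : rel S := undirected (glued_hasse [:: hatWb; hatWc; Wprime]).

End WGluedDiamond.

(** * Measures (given by point masses) and distribution functions *)

Section Measures.
Context {disp : Order.disp_t} {S : finPOrderType disp} {R : realType}.
Local Open Scope ring_scope.
Implicit Types P : S -> R.

Definition mass P (B : {set S}) : R := \sum_(x in B) P x.

Definition stoch_le P P' : Prop :=
  mass P [set: S]%SET = mass P' [set: S]%SET /\
  forall U : {set S}, up_set U -> mass P U <= mass P' U.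

(* The distribution function of a measure Q on the poset induced on D, whose
   Hasse diagram is a tree rooted at tau. *)
Definition distribution_function (D : {set S}) (tau : S) (Q : S -> R) (x : S)
    : R :=
  \sum_(z in D | tree_le (undirected (hasse D)) tau z x) Q z.

Variables (G : glue_data S) (P1 P2 : S -> R).
Local Notation a := (ga G).
Local Notation b := (gb G).
Local Notation c := (gc G).
Local Notation d := (gd G).

Definition q' : R := Num.max (mass P1 (Wb G)) (mass P2 (Wb G)).
Definition q'' : R := Num.max (mass P1 (Wc G)) (mass P2 (Wc G)).

(* Used with (V, v, q) = (Wb, b, q') and (Wc, c, q''); only the values on
   d |: V matter. *)
Definition Qeta1 (V : {set S}) (v : S) (q : R) (y : S) : R :=
  if y == d then 0
  else if y == v then q - mass P1 (V :\ v) else P1 y.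

Definition Qeta2 (V : {set S}) (q : R) (y : S) : R :=
  if y == d then q - mass P2 V else P2 y.

Definition Pprime1 (y : S) : R :=
  if y == a then mass P1 (a |: (Wb G :|: Wc G)) - q' - q'' else P1 y.

Definition Pprime2 (y : S) : R :=
  if y == d then mass P2 (d |: (Wb G :|: Wc G)) - q' - q'' else P2 y.

Definition F1 (y : S) : R :=
  if y == d then mass P1 [set: S]%SET
  else if y \in Wb G then
    distribution_function (hatWb G) d (Qeta1 (Wb G) b q') y
  else if y \in Wc G then
    distribution_function (hatWc G) d (Qeta1 (Wc G) c q'') y
  else distribution_function (Wprime G) d Pprime1 y.

Definition F2 (y : S) : R :=
  if y == d then mass P2 [set: S]%SET
  else if y \in Wb G then
    distribution_function (hatWb G) d (Qeta2 (Wb G) q') y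
  else if y \in Wc G then
    distribution_function (hatWc G) d (Qeta2 (Wc G) q'') y
  else distribution_function (Wprime G) d Pprime2 y.

End Measures.

(** * The plane tree of indices *)

(* kappa |-> (ihead kappa :: itail kappa) is the descending path u^(kappa),
   and isub kappa is the vertex set of the subtree W^(kappa). *)
Record index_data (T : finType) := IndexData {
  idx :> finType;
  iroot : idx;
  ichildren : idx -> seq idx;
  ihead : idx -> T;
  itail : idx -> seq T;
  isub : idx -> {set T} }.

Section IndexTree.
Context {T : finType} (K : index_data T).
Implicit Types kappa sigma : idx K.

Definition upath kappa : seq T := ihead kappa :: itail kappa.
Definition ustar kappa : T := last (ihead kappa) (itail kappa).

Definition parent kappa : option K := [pick k | kappa \in ichildren k].

Definition hat_upath kappa : seq T :=
  if parent kappa is Some k then ustar k :: upath kappa else upath kappa.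

Variables (e : rel T) (tau : T).

Definition child_rel : rel K := fun kappa sigma => sigma \in ichildren kappa.

(* Adjacency after removing the vertices of u^(kappa) from W^(kappa). *)
Definition residual kappa : rel T := fun x y =>
  let D := isub kappa :\: [set z in upath kappa]%SET in
  [&& x \in D, y \in D & e x y].

Record index_tree : Prop := {
  it_sub_root : isub (iroot K) = [set: T]%SET;
  it_head_root : ihead (iroot K) = tau;
  it_path : forall kappa,
    path (fun x y => y \in successors e tau (isub kappa) x)
         (ihead kappa) (itail kappa);
  it_inner : forall kappa, {in belast (ihead kappa) (itail kappa),
    forall x, #|successors e tau (isub kappa) x| = 1%N};
  it_last : forall kappa, #|successors e tau (isub kappa) (ustar kappa)| <> 1%N;
  it_children : forall kappa,
    perm_eq [seq ihead sigma | sigma <- ichildren kappa]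
            (enum (successors e tau (isub kappa) (ustar kappa)));
  it_sub_child : forall kappa sigma, sigma \in ichildren kappa ->
    isub sigma = [set x | connect (residual kappa) (ihead sigma) x]%SET;
  it_reach : forall kappa, connect child_rel (iroot K) kappa }.

End IndexTree.

(* The prescribed order eta_b, eta_c, eta_a, zeta_1, ..., zeta_M at the root. *)
Definition root_order {disp : Order.disp_t} {S : finPOrderType disp}
    (G : glue_data S) (K : index_data S) : Prop :=
  exists zs : seq S,
    [seq ihead sigma | sigma <- ichildren (iroot K)]
      = [:: gb G, gc G, ga G & zs] /\
    perm_eq zs (enum [set z | hasse (Wd G) z (gd G)]%SET).

(** * Interlacing and the recursive inverse transform *)

Section InverseTransform.
Context {T : finType} {R : realType} (K : index_data T).
Variables (e : rel T) (tau : T).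
Implicit Types (mu : K -> R) (F : T -> R) (kappa : idx K) (omega : R).
Local Open Scope ring_scope.

Definition mu_minus mu kappa : R := \sum_(sigma <- ichildren kappa) mu sigma.

Definition is_distribution mu : Prop :=
  forall kappa, 0 <= mu kappa /\ mu_minus mu kappa <= mu kappa.

Definition interlaced mu F : Prop :=
  mu (iroot K) = F tau /\
  forall kappa, [/\ mu_minus mu kappa <= F (ustar kappa),
                    F (ustar kappa) <= F (ihead kappa)
                  & F (ihead kappa) <= mu kappa].

(* On the path hat_upath kappa, the only vertex outside isub kappa is the end
   ustar of the path of the parent of kappa (if kappa is not the root). *)
Definition F_index mu F kappa (x : T) : R :=
  if x \in isub kappa then F x else mu kappa.

Definition child_sum mu kappa (j : nat) : R :=
  \sum_(sigma <- take j (ichildren kappa)) mu sigma.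

Definition path_min mu F kappa omega : T :=
  let L := [set x in hat_upath kappa | omega < F_index mu F kappa x]%SET in
  odflt tau [pick m in L | [forall x in L, tree_le e tau m x]].

(* [n] is fuel: the value is the intended one as soon as [n] exceeds the height
   of the subtree of indices at kappa, and [tau] is a junk default.  Here j is
   0-based, so that child number j (from 0) is used when omega lies between
   [child_sum mu kappa j] and [child_sum mu kappa j.+1]. *)
Fixpoint inverse_transform_rec (n : nat) mu F kappa omega : T :=
  if n is n'.+1 then
    if omega < mu_minus mu kappa then
      if [pick j : 'I_(size (ichildren kappa)) |
            child_sum mu kappa j <= omega < child_sum mu kappa j.+1] is Some j
      then inverse_transform_rec n' mu F (nth kappa (ichildren kappa) j)
             (omega - child_sum mu kappa j)
      else tau
    else path_min mu F kappa omega
  else tau.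

Definition inverse_transform mu F : R -> T :=
  inverse_transform_rec #|K| mu F (iroot K).

End InverseTransform.

(** * Modifications *)

Section Modification.
Context {S : finType} {R : realType}.
Local Open Scope classical_set_scope.
Local Open Scope ring_scope.

(* Functions on [0, p) are represented by functions on R, of which only the
   values on [0, p) are meaningful. *)
Definition level_set (p : R) (Y : R -> S) (B : {set S}) : set R :=
  [set omega | 0 <= omega < p /\ Y omega \in B].

Definition modification (G : glue_data S) (p : R) (X1 X2 Y1 Y2 : R -> S)
    : Prop :=
  (forall omega, 0 <= omega < p -> Y2 omega = X2 omega) /\
  exists M : set R,
    [/\ measurable M, M `<=` level_set p X1 [set gb G; gc G]%SET
      & forall omega, 0 <= omega < p ->
          Y1 omega = if omega \in M then ga G else X1 omega].

End Modification.

(* Main.v *)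
(* The two inverse transforms descend the index tree in the same way, so at each
   [omega] both values lie on one path of the tree.  If one is strictly deeper
   than the other, then [F1] and [F2] compare strictly the same way on all the
   edges in between; but removing an edge of the Hasse diagram cuts off an up-set
   or a down-set, so stochastic order makes all those edges point in the right
   direction, and [X1 omega <= X2 omega].

   The inverse transforms are step functions, so their laws are finite sums; an
   induction on indices shows that [X_i] has the law of which [F_i] is the
   distribution function on the tree.  For [i = 2] this is [P2]; for [i = 1] it
   differs from [P1] by the masses [q' - P1 Wb] and [q'' - P1 Wc], transported
   from [a] to [b] and [c].  Moving them back changes [X1] from [b] or [c] to the
   smaller value [a], which preserves the order. *)

Require Import Defs.
From mathcomp Require Import all_boot all_order all_algebra.
From mathcomp Require Import all_classical all_reals all_analysis.
From mathcomp Require Import lra.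

Set Implicit Arguments.
Unset Strict Implicit.
Unset Printing Implicit Defensive.

Import Order.TTheory GRing.Theory Num.Theory.
Local Open Scope ring_scope.

(** * Rooted trees *)

(** The Hasse diagram of [S] contains the cycle [a], [b], [d], [c], so cutting an edge yields an
    up-set or a down-set only off the diamond. The tree replaces this cycle by three edges from [d]
    to [a], [b] and [c], the first of which is not a cover of [S]. As [a], [b], [c] lie below [d],
    these edges require [F2 <= F1]. The subtree at [b] is [Wb], neither an up-set nor a down-set, so
    stochastic order does not compare its two masses; [q'] is the least mass that dominates both,
    and likewise [q''] for [Wc]. The added mass is taken from [a]. That enough remains there follows
    from the down-sets formed by adding to [[set a]] or to [Wa] nothing, [Wb], [Wc] or both: one for
    each way in which the two maxima are attained. The law needs a strengthened induction, because
    the mass of a vertex that ends an index path is scattered: a part of it is produced inside the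
    intervals of the child indices, wherever [mu] exceeds [F] at their heads. *)

Section UniquePaths.
Variables (T : finType) (e : rel T).

(** Two simple paths that disagree at once leave [x] for different neighbours [z] and [w]. These are
    joined through [y] without visiting [x], and closing up at [x] gives a cycle of length at least
    three. *)
Lemma acyclic_simple_path_uniq x y p q : symmetric e -> acyclic_graph e ->
  simple_path e x y p -> simple_path e x y q -> p = q.
Proof.
move=> e_sym e_acy; elim: p x q => [|z p IHp] x [|w q] //.
- move=> /and3P[_ /eqP <- _] /and3P[_ /eqP /= ql /andP[]].
  by rewrite -{1}ql mem_last.
- move=> /and3P[_ /eqP /= pl /andP[+ _]] /and3P[_ /eqP /= xy _].
  by rewrite xy -{1}pl mem_last.
move=> /and3P[/= /andP[exz zp] pl /andP[xNp pu]].
move=> /and3P[/= /andP[exw wq] ql /andP[xNq qu]].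
have [wz|wNz] := eqVneq z w.
  by subst w; congr (_ :: _); apply: (IHp z); rewrite /simple_path ?zp ?wq ?pl ?ql.
exfalso.
(* [z] and [w] are joined by [p] and [q] without visiting [x]. *)
pose e' u v := [&& e u v, u != x & v != x].
have sub u s : x \notin u :: s -> path e u s -> path e' u s.
  elim: s u => //= v s IHs u; rewrite !inE !negb_or => /and3P[xu xv xs].
  case/andP=> uv vs; rewrite /e' uv eq_sym xu eq_sym xv /=.
  by apply: IHs; rewrite // inE negb_or xv.
have e'_sym : symmetric e' by move=> u v; rewrite /e' e_sym [(u != x) && _]andbC.
have : connect e' z w.
  apply: (@connect_trans _ _ y).
    by apply/connectP; exists p; [apply: sub | rewrite (eqP pl)].
  rewrite (sym_connect_sym e'_sym).
  by apply/connectP; exists q; [apply: sub | rewrite (eqP ql)].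
case/connectP=> s0 zs0; case/shortenP: zs0 => s zs su _ {s0} wl.
have xNs : x \notin z :: s.
  move: (xNp); rewrite !inE !negb_or => /andP[-> _] /=.
  elim: s z zs {su wl xNp zp pl pu wNz exz} => //= v s IHs u /andP[/and3P[_ _ vx] vs].
  by rewrite inE negb_or eq_sym vx; apply: IHs vs.
have /negP : ~~ cycle e [:: x, z & s].
  apply: e_acy; last by rewrite cons_uniq xNs.
  by case: s wl {zs su xNs} => //= wz; rewrite wz eqxx in wNz.
apply; rewrite /= exz rcons_path -wl (e_sym w) exw andbT.
by apply: sub_path zs => u v /and3P[].
Qed.

End UniquePaths.

Record rooted_tree (T : finType) (e : rel T) (tau : T) : Prop := {
  rt_sym : symmetric e;
  rt_irr : irreflexive e;
  rt_conn : forall x, connect e tau x;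
  rt_uniq : forall x p q,
    simple_path e tau x p -> simple_path e tau x q -> p = q }.

Lemma connect_simple_path (T : finType) (e : rel T) x y :
  connect e x y -> exists p, simple_path e x y p.
Proof.
case/connectP=> p0 xp0; case/shortenP: xp0 => p xp pu _ yl.
by exists p; rewrite /simple_path xp -yl eqxx.
Qed.

Section RootedTreeTheory.
Variables (T : finType) (e : rel T) (tau : T).
Hypothesis eT : rooted_tree e tau.

Definition rpath x : seq T :=
  xchoose (connect_simple_path (rt_conn eT x)).

Lemma rpathP x : simple_path e tau x (rpath x).
Proof. exact: (xchooseP (connect_simple_path (rt_conn eT x))). Qed.

Lemma rpathE x p : simple_path e tau x p -> rpath x = p.
Proof. by apply: (rt_uniq eT); apply: rpathP. Qed.

Lemma last_rpath x : last tau (rpath x) = x.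
Proof. by have /and3P[_ /eqP] := rpathP x. Qed.

Lemma rpath_inj : injective rpath.
Proof. by move=> x y xy; rewrite -(last_rpath x) xy last_rpath. Qed.

Lemma rpath_root : rpath tau = [::].
Proof. by apply: rpathE; rewrite /simple_path /= eqxx. Qed.

Lemma tree_leE x y : tree_le e tau x y = (y \in tau :: rpath x).
Proof.
apply/idP/idP => [/asboolP[p [q [xp yq sub]]]|yx].
  by rewrite (rpathE xp) -(last_rpath y) (rpathE yq) sub ?mem_last.
apply/asboolP; exists (rpath x), (rpath y); split; rewrite ?rpathP //.
have := rpathP x; case/splitPl: yx => p1 p2 p1y.
rewrite /simple_path cat_path -cat_cons cat_uniq.
case/and3P=> /andP[tp1 _] _ /and3P[p1u _ _].
rewrite (@rpathE y p1) ?/simple_path ?tp1 ?p1y ?eqxx // => z.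
by rewrite !inE mem_cat => /orP[->|->]; rewrite ?orbT.
Qed.

(** Turns the tree order into the prefix order on root paths, whence its order properties. The
    deeper vertex stands on the left and the root is the greatest element. *)
Lemma tree_le_prefix x y : tree_le e tau x y = prefix (rpath y) (rpath x).
Proof.
rewrite tree_leE; apply/idP/idP => [yx|/prefixP[q ->]]; last first.
  by rewrite -{1}(last_rpath y) -cat_cons mem_cat mem_last.
have := rpathP x; case/splitPl: yx => p1 p2 p1y.
rewrite /simple_path cat_path -cat_cons cat_uniq.
case/and3P=> /andP[tp1 _] _ /and3P[p1u _ _].
by rewrite (@rpathE y p1) ?prefix_prefix // /simple_path tp1 p1y eqxx.
Qed.

Lemma tree_le_refl x : tree_le e tau x x.
Proof. by rewrite tree_le_prefix prefix_refl. Qed.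

Lemma tree_le_trans y x z :
  tree_le e tau x y -> tree_le e tau y z -> tree_le e tau x z.
Proof. by rewrite !tree_le_prefix => yx zy; apply: prefix_trans zy yx. Qed.

Lemma tree_le_anti x y : tree_le e tau x y -> tree_le e tau y x -> x = y.
Proof.
rewrite !tree_le_prefix => yx xy; apply: rpath_inj.
move: (yx); rewrite prefixE => /eqP; rewrite take_oversize //.
exact: size_prefix xy.
Qed.

Lemma tree_le_root x : tree_le e tau x tau.
Proof. by rewrite tree_le_prefix rpath_root prefix0s. Qed.

(** The second argument is the deeper one. In the poset a child may lie above or below its
    parent. *)
Definition child x y := e x y && tree_le e tau y x.

Lemma childE x y : child x y = (rpath y == rcons (rpath x) y).
Proof.
apply/andP/eqP => [[exy yx]|yE].
  apply: rpathE.
  have yNx : y \notin tau :: rpath x.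
    rewrite -tree_leE; apply/negP => xy.
    by rewrite (tree_le_anti xy yx) (rt_irr eT) in exy.
  have /and3P[tx _ xu] := rpathP x.
  rewrite /simple_path rcons_path tx last_rpath exy last_rcons eqxx.
  by rewrite -rcons_cons rcons_uniq yNx xu.
have /and3P[] := rpathP y; rewrite yE rcons_path last_rpath => /andP[_ ->] _ _.
by rewrite tree_le_prefix yE -cats1 prefix_prefix.
Qed.

Lemma child_uniq x x' y : child x y -> child x' y -> x = x'.
Proof.
rewrite !childE => /eqP -> /eqP /eqP; rewrite eqseq_rcons eqxx andbT => /eqP.
exact: rpath_inj.
Qed.

Lemma child_le x y : child x y -> tree_le e tau y x.
Proof. by case/andP. Qed.

Lemma child_root x : ~~ child x tau.
Proof. by rewrite childE rpath_root; case: (rpath x). Qed.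

Lemma child_parentN x y : child x y -> ~~ tree_le e tau x y.
Proof.
case/andP=> exy yx; apply/negP => xy.
by rewrite (tree_le_anti xy yx) (rt_irr eT) in exy.
Qed.

Lemma edge_child x y : e x y -> child x y \/ child y x.
Proof.
move=> exy; have [xy|xNy] := boolP (tree_le e tau x y).
  by right; rewrite /child (rt_sym eT) exy.
left; rewrite childE; apply/eqP/rpathE.
have /and3P[tx _ xu] := rpathP x.
rewrite /simple_path rcons_path tx last_rpath exy last_rcons eqxx.
by rewrite -rcons_cons rcons_uniq -tree_leE xNy xu.
Qed.

Lemma child_tree_le_up x y z :
  child x y -> tree_le e tau y z -> y != z -> tree_le e tau x z.
Proof.
rewrite childE !tree_le_prefix => /eqP yE /prefixP[s].
rewrite yE; elim/last_ind: s => [|s w _].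
  rewrite cats0 => zE; rewrite (_ : y = z) ?eqxx //.
  by apply: rpath_inj; rewrite yE zE.
by rewrite -rcons_cat => /rcons_inj[-> _]; rewrite prefix_prefix.
Qed.

(** Subtrees are cuts: their boundary is crossed only between the top and its parent. Both the
    components that define [isub] and the cuts of the poset rest on this. *)
Lemma edge_leaving x y z : e x y -> tree_le e tau x z ->
  ~~ tree_le e tau y z -> x = z /\ child y x.
Proof.
case/edge_child=> [xy xz /negP[]|yx xz yNz].
  exact: tree_le_trans (child_le xy) xz.
split=> //; apply/eqP; apply: contraNT yNz => xNz.
exact: child_tree_le_up yx xz xNz.
Qed.

Lemma in_successors (D : {set T}) x y :
  (y \in successors e tau D x) = (y \in D) && child x y.
Proof. by rewrite inE. Qed.

Definition subtree x : {set T} := [set z | tree_le e tau z x]%SET.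

Lemma successors_subtree h x : tree_le e tau x h ->
  successors e tau (subtree h) x = successors e tau [set: T]%SET x.
Proof.
move=> xh; apply/setP=> y; rewrite !in_successors !inE /=.
by case: (boolP (child x y)) => [/child_le yx|]; rewrite ?andbF // (tree_le_trans yx).
Qed.

(* The successor of [x] towards [z] is found on the path to [z] just after
   the path to [x]. *)
Lemma subtree_next x z : tree_le e tau z x -> z != x ->
  let y := nth tau (rpath z) (size (rpath x)) in
  child x y /\ tree_le e tau z y.
Proof.
move=> zx zNx; have := rpathP z; move: (zx); rewrite tree_le_prefix.
case/prefixP=> -[|y s] zE.
  by rewrite cats0 in zE; rewrite (rpath_inj zE) eqxx in zNx.
rewrite zE nth_cat ltnn subnn /= /simple_path -cat_rcons cat_path -cat_cons.
rewrite cat_uniq => /and3P[/andP[ty _] _ /and3P[yu _ _]].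
have yE : rpath y = rcons (rpath x) y.
  by apply: rpathE; rewrite /simple_path ty last_rcons eqxx.
split; first by rewrite childE yE.
by rewrite tree_le_prefix zE yE -cat_rcons prefix_prefix.
Qed.

(** The vertices strictly below [x] are sorted by the first vertex after [x] on their root path. For
    point masses [g] this is the recursion of a distribution function. *)
Lemma sum_subtree (V : nmodType) (g : T -> V) x :
  \sum_(z | tree_le e tau z x) g z =
  g x + \sum_(y in successors e tau [set: T]%SET x)
          \sum_(z | tree_le e tau z y) g z.
Proof.
rewrite (bigD1 x) ?tree_le_refl //=; congr (_ + _).
pose next z := nth tau (rpath z) (size (rpath x)).
rewrite (partition_big next (mem (successors e tau [set: T]%SET x))) /=.
  apply: eq_bigr => y; rewrite in_successors inE /= => xy.
  apply: eq_bigl => z; apply/idP/idP => [/andP[/andP[zx zNx] /eqP <-]|zy].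
    by have [] := subtree_next zx zNx.
  rewrite (tree_le_trans zy (child_le xy)) /=; apply/andP; split.
    apply: contraNneq (child_parentN xy) => zx; rewrite -zx //.
  apply/eqP; move: zy xy; rewrite tree_le_prefix childE => /prefixP[s].
  by rewrite /next => -> /eqP ->; rewrite cat_rcons nth_cat ltnn subnn.
move=> z /andP[zx zNx]; rewrite in_successors inE.
by have [] := subtree_next zx zNx.
Qed.

End RootedTreeTheory.

(** Distribution functions are defined with the tree order of a single glued piece. A simple path
    found in the piece is the unique one in the whole tree, so the two orders agree. *)
Lemma tree_le_subrel (T : finType) (e e' : rel T) (tau x y : T) :
  rooted_tree e tau -> subrel e' e -> connect e' tau x -> connect e' tau y ->
  tree_le e' tau x y = tree_le e tau x y.
Proof.
move=> eT ee' /connect_simple_path[p xp] /connect_simple_path[q yq].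
have sub z r : simple_path e' tau z r -> simple_path e tau z r.
  by case/and3P=> zr rl ru; rewrite /simple_path (sub_path ee' zr) rl ru.
apply/asboolP/asboolP=> -[p' [q' [xp' yq' pq]]].
  by exists p', q'; split=> //; apply: sub.
exists p, q; split=> //.
by rewrite (rt_uniq eT (sub _ _ xp) xp') (rt_uniq eT (sub _ _ yq) yq').
Qed.

(** * Step functions *)

Section StepFunctions.
Variables (R : realType) (T : finType).
Implicit Types (s : seq (R * T)) (B : {set T}) (g : T -> R).

(** Lengths and values are laid end to end from [0]; past the end the default [x0] is taken. Steps
    of length zero are allowed, so coinciding values of a distribution function need no special
    case. *)
Fixpoint step_fun (x0 : T) s (w : R) : T :=
  if s is (l, v) :: s' then if w < l then v else step_fun x0 s' (w - l) else x0.

Definition nonneg_steps s : bool := all (fun q => 0 <= q.1) s.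

(** The integral of [g] against the law of the step function; test functions instead of sets keep
    the later computations linear. *)
Definition step_sum s g : R := \sum_(q <- s) q.1 * g q.2.

Definition step_length s : R := \sum_(q <- s) q.1.

Lemma step_length_ge0 s : nonneg_steps s -> 0 <= step_length s.
Proof. by move=> /allP s0; rewrite /step_length big_seq sumr_ge0. Qed.

Lemma step_length_cons l v s : step_length ((l, v) :: s) = l + step_length s.
Proof. by rewrite /step_length big_cons. Qed.

Lemma step_length_cat s1 s2 :
  step_length (s1 ++ s2) = step_length s1 + step_length s2.
Proof. by rewrite /step_length big_cat. Qed.

Lemma step_sum_cons l v s g :
  step_sum ((l, v) :: s) g = l * g v + step_sum s g.
Proof. by rewrite /step_sum big_cons. Qed.

Lemma step_sum_cat s1 s2 g : step_sum (s1 ++ s2) g = step_sum s1 g + step_sum s2 g.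
Proof. by rewrite /step_sum big_cat. Qed.

Lemma step_fun_catl x0 s1 s2 w : 0 <= w < step_length s1 ->
  step_fun x0 (s1 ++ s2) w = step_fun x0 s1 w.
Proof.
elim: s1 w => [|[l v] s1 IHs] w /=.
  by rewrite /step_length big_nil => /andP[w0]; rewrite ltNge w0.
rewrite step_length_cons => /andP[w0 wl]; case: ltrP => // lw.
by apply: IHs; rewrite subr_ge0 lw ltrBlDl.
Qed.

Lemma step_fun_catr x0 s1 s2 w : nonneg_steps s1 -> step_length s1 <= w ->
  step_fun x0 (s1 ++ s2) w = step_fun x0 s2 (w - step_length s1).
Proof.
elim: s1 w => [|[l v] s1 IHs] w /=; first by rewrite /step_length big_nil subr0.
move=> /andP[l0 s10]; rewrite step_length_cons => lw.
have len0 := step_length_ge0 s10.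
rewrite ltNge (le_trans _ lw) ?lerDl //= IHs ?lerBrDl //.
by rewrite opprD addrA.
Qed.

(** The starting point [t] is arbitrary because the induction shifts it by the length of the head.
    The set is the disjoint union of the head interval, if its value lies in [B], and the set for
    the tail. *)
Lemma step_fun_law x0 s B (t : R) : nonneg_steps s ->
  let A := [set w : R | t <= w < t + step_length s /\
                        step_fun x0 s (w - t) \in B]%classic in
  measurable A /\
  lebesgue_measure A = (step_sum s (fun x => (x \in B)%:R))%:E.
Proof.
elim: s t => [|[l v] s IHs] t /=.
  rewrite /step_length /step_sum !big_nil addr0 => _.
  suff -> : [set w : R | t <= w < t /\ x0 \in B]%classic = set0.
    by rewrite measure0; split=> //; apply: measurable0.
  by apply/seteqP; split=> // w [/andP[/le_lt_trans tw /tw]]; rewrite ltxx.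
move=> /andP[l0 s0]; rewrite step_length_cons step_sum_cons.
have len0 := step_length_ge0 s0.
have [mA lA] := IHs (t + l) s0.
set A := [set _ | _]%classic in mA lA.
set C := [set _ | _]%classic.
pose I : set R := if v \in B then [set` `[t, t + l[%R]%classic else set0.
have mI : measurable I by rewrite /I; case: ifP.
have lI : lebesgue_measure I = (l * (v \in B)%:R)%:E.
  rewrite /I; case: ifP => _; rewrite ?mulr0 ?measure0 // mulr1.
  rewrite lebesgue_measure_itv /= lte_fin ltrDl; case: ltrP => [_|l_le0].
    by rewrite -EFinB addrC addKr.
  by rewrite (@le_anti _ _ l 0) // l0 l_le0.
have -> : C = (I `|` A)%classic.
  apply/seteqP; split=> w; have wlE : w - (t + l) = w - t - l.
  - by rewrite opprD addrA.
  - rewrite /C /A /I /= => -[/andP[tw wt]]; rewrite ltrBlDl.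
    case: ltrP => wl vB.
      by left; rewrite vB /= in_itv /= tw wl.
    by right; rewrite wlE /= -addrA.
  - by rewrite opprD addrA.
  rewrite /C /A /I /=; case: ifP => vB [].
  - rewrite /= in_itv /= => /andP[tw wl]; rewrite ltrBlDl wl tw; split=> //.
    by rewrite (lt_le_trans wl) // addrA lerDl.
  - rewrite wlE => -[/andP[tw wl] wB].
    by rewrite [w - t < l]ltrBlDl [w < t + l]ltNge tw addrA wl (le_trans _ tw) ?lerDl.
  - by [].
  - rewrite wlE => -[/andP[tw wl] wB].
    by rewrite [w - t < l]ltrBlDl [w < t + l]ltNge tw addrA wl (le_trans _ tw) ?lerDl.
split; first exact: measurableU.
have -> : lebesgue_measure (I `|` A)%classic =
    (lebesgue_measure I + lebesgue_measure A)%E; last by rewrite lI lA.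
apply: measureU => //; apply/seteqP; split=> // w []; rewrite /I /A /=; case: ifP => //= _.
by rewrite in_itv /= => /andP[_ wl] [/andP[]]; rewrite leNgt wl.
Qed.

(** Greedy: steps with value [v] are relabelled from the left until length [m] is used up, and the
    step in which this happens is split in two. This is what moves mass back to [a]. *)
Lemma step_fun_replace x0 s (v a : T) (m : R) : nonneg_steps s ->
  0 <= m <= step_sum s (fun x => (x == v)%:R) ->
  exists s', [/\ nonneg_steps s', step_length s' = step_length s,
    forall g, step_sum s' g = step_sum s g + m * (g a - g v)
  & forall w, step_fun x0 s' w = step_fun x0 s w \/
      step_fun x0 s w = v /\ step_fun x0 s' w = a].
Proof.
elim: s m => [|[l u] s IHs] m /=.
  rewrite /step_sum big_nil => _ m0; have {m0}-> : m = 0 by apply: le_anti; rewrite andbC.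
  by exists [::]; split=> // [g|w]; [rewrite mul0r addr0|left].
move=> /andP[l0 s0]; rewrite step_sum_cons /= => /andP[m0].
have [-> ml|uv ml] := eqVneq u v; last first.
  have [|s' [s'0 s'l s'g s'w]] := IHs m s0.
    by rewrite m0 -(add0r (step_sum _ _)) -(mulr0 l).
  exists ((l, u) :: s'); split=> [|| g|w] /=; rewrite ?l0 //.
  - by rewrite !step_length_cons s'l.
  - by rewrite !step_sum_cons s'g addrA.
  - by case: ifP => _; [left | apply: s'w].
have [lm|lm] := lerP m l.
  exists [:: (m, a), (l - m, v) & s]; split=> [|| g|w] /=.
  - by rewrite m0 subr_ge0 lm s0.
  - by rewrite !step_length_cons addrA subrKC.
  - by rewrite !step_sum_cons; lra.
  - rewrite ltrBlDr subrK; case: ltrP => wm.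
      by rewrite (lt_le_trans wm lm); right.
    by case: ltrP => wl; left=> //; congr step_fun; lra.
have [|s' [s'0 s'l s'g s'w]] := IHs (m - l) s0.
  by rewrite subr_ge0 (ltW lm) lerBlDl -{1}(mulr1 l).
exists ((l, a) :: s'); split=> [|| g|w] /=; rewrite ?l0 //.
- by rewrite !step_length_cons s'l.
- by rewrite !step_sum_cons s'g; lra.
- by case: ifP => _; [right | apply: s'w].
Qed.

End StepFunctions.

(** * The inverse transform as a step function *)

Section IndexTreeTheory.
Variables (T : finType) (e : rel T) (tau : T) (K : index_data T).
Hypotheses (eT : rooted_tree e tau) (KT : index_tree K e tau).

Implicit Types (kappa sigma : idx K).

Local Notation succ := (successors e tau [set: T]%SET).
Local Notation le := (tree_le e tau).

Lemma parent_exists x : x != tau -> exists w, child e tau w x.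
Proof.
move=> xNtau; have := rpathP eT x; case xE: (rpath eT x) => [|y s].
  by case/and3P=> _ /= /eqP taux; rewrite taux eqxx in xNtau.
have := last_rpath eT x; rewrite xE.
case/lastP: {y s} (y :: s) xE => [_ /esym/eqP|p z xE]; first by rewrite (negPf xNtau).
rewrite last_rcons => zx; move: xE; rewrite {}zx => xE.
rewrite -cats1 /simple_path cat_path -cat_cons cat_uniq.
case/and3P=> /andP[tp _] _ /and3P[pu _ _].
exists (last tau p); rewrite (childE eT) xE (@rpathE _ _ _ eT _ p) //.
by rewrite /simple_path tp eqxx.
Qed.

Lemma path_child_le x s : path (child e tau) x s ->
  forall y, y \in x :: s -> le (last x s) y && le y x.
Proof.
elim: s x => [|z s IHs] x /= => [_|/andP[xz zs]] y; rewrite inE.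
  by move=> /eqP ->; rewrite tree_le_refl.
case/predU1P=> [->|/(IHs _ zs)/andP[-> yz]]; last first.
  by rewrite (tree_le_trans eT yz (child_le xz)).
rewrite (tree_le_refl eT) andbT.
have /andP[sz _] := IHs z zs z (mem_head _ _).
exact: (tree_le_trans eT sz (child_le xz)).
Qed.

Lemma upath_child kappa : path (child e tau) (ihead kappa) (itail kappa).
Proof.
apply: sub_path (it_path KT kappa) => x y.
by rewrite in_successors => /andP[].
Qed.

Lemma ustar_le kappa x : x \in upath kappa -> le (ustar kappa) x.
Proof. by move/(path_child_le (upath_child kappa))/andP=> []. Qed.

Lemma upath_le kappa x : x \in upath kappa -> le x (ihead kappa).
Proof. by move/(path_child_le (upath_child kappa))/andP=> []. Qed.

Lemma ustar_upath kappa : ustar kappa \in upath kappa.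
Proof. exact: mem_last. Qed.

Lemma ihead_child kappa sigma : sigma \in ichildren kappa ->
  child e tau (ustar kappa) (ihead sigma).
Proof.
move=> sk; have : ihead sigma \in [seq ihead s | s <- ichildren kappa].
  exact: map_f.
by rewrite (perm_mem (it_children KT kappa)) mem_enum in_successors => /andP[].
Qed.

Lemma index_ind (Q : K -> Prop) : Q (iroot K) ->
  (forall kappa sigma, sigma \in ichildren kappa -> Q kappa -> Q sigma) ->
  forall kappa, Q kappa.
Proof.
move=> Q0 QS kappa; have /connectP[s] := it_reach KT kappa.
elim/last_ind: s kappa => [|s k IHs] kappa; first by move=> _ ->.
rewrite rcons_path last_rcons => /andP[/IHs ps sk] ->.
by apply: QS sk _; apply: ps.
Qed.

(** By top-down induction on indices. A component cannot leave the subtree of its head, since the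
    only exit leads to [ustar kappa], which has been removed; conversely every vertex of that
    subtree climbs to the head. *)
Lemma isubE kappa : isub kappa = subtree e tau (ihead kappa).
Proof.
elim/index_ind: kappa => [|kappa sigma sk IHk].
  rewrite (it_sub_root KT) (it_head_root KT); apply/setP=> x.
  by rewrite !inE tree_le_root.
have ky := ihead_child sk; set y := ihead sigma in ky *.
rewrite (it_sub_child KT sk) -/y.
have yk : le y (ihead kappa).
  exact: (tree_le_trans eT (child_le ky) (upath_le (ustar_upath _))).
have yN x : le x y -> x \notin upath kappa.
  move=> xy; apply/negP => /ustar_le kx.
  by have /negP := child_parentN eT ky; apply; apply: (tree_le_trans eT kx xy).
have residualE u v : residual e kappa u v =
    [&& le u (ihead kappa), u \notin upath kappa,
        le v (ihead kappa), v \notin upath kappa & e u v].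
  rewrite /residual IHk !finset.in_setD !finset.in_set.
  by case: (u \in _) (le u _) (v \in _) (le v _) => [] [] [] [].
apply/setP=> z; rewrite !inE; apply/idP/idP => [|zy].
  case/connectP=> s + ->; move: (tree_le_refl eT y).
  elim: s {1 3 4}y => //= v s IHs u uy /andP[+ vs] => uv; apply: (IHs v) vs; move: uv.
  rewrite residualE => /and5P[_ uN _ vN uv].
  have [//|vNy] := boolP (le v y).
  have [uE vu] := edge_leaving eT uv uy vNy; rewrite uE in vu.
  by rewrite (child_uniq eT vu ky) ustar_upath in vN.
(* Induction on the depth of [z]: its parent [w] is still below [y] and has a shorter root path. *)
have [n zn] := ubnP (size (rpath eT z)); elim: n z zy zn => // n IHn z zy zn.
have [->|zNy] := eqVneq z y; first exact: connect0.
have zNtau : z != tau.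
  apply: contraNneq zNy => zE; apply/eqP; apply: (tree_le_anti eT zy).
  by rewrite zE tree_le_root.
have [w wz] := parent_exists zNtau.
have wy := child_tree_le_up eT wz zy zNy.
apply: connect_trans (IHn w wy _) (connect1 _).
  by move: wz zn; rewrite (childE eT) => /eqP ->; rewrite size_rcons ltnS.
rewrite residualE !yN // (tree_le_trans eT wy yk) (tree_le_trans eT zy yk).
by case/andP: wz.
Qed.

Lemma upath_isub kappa x : x \in upath kappa -> x \in isub kappa.
Proof. by rewrite isubE finset.in_set; apply: upath_le. Qed.

Lemma successors_isub kappa x : x \in upath kappa ->
  successors e tau (isub kappa) x = succ x.
Proof. by move=> xk; rewrite isubE (successors_subtree eT) ?upath_le. Qed.

Lemma sum_children (V : nmodType) (g : T -> V) kappa :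
  \sum_(sigma <- ichildren kappa) g (ihead sigma) =
  \sum_(y in succ (ustar kappa)) g y.
Proof.
rewrite -(big_map (@ihead T K) predT) (perm_big _ (it_children KT kappa)).
by rewrite big_enum successors_isub ?ustar_upath.
Qed.

(* At the root index, which has no vertex above it, the head itself is taken:
   the corresponding interval is then empty because [mu] and [F] agree there. *)
Definition above (kappa : K) : T :=
  if parent kappa is Some k then ustar k else ihead kappa.

Lemma parentP kappa k : parent kappa = Some k -> kappa \in ichildren k.
Proof. by rewrite /parent; case: pickP => //= j kj [<-]. Qed.

(** [parent] picks some index that lists [sigma]; whichever it is, its [ustar] is the unique parent
    vertex of the head of [sigma]. *)
Lemma above_child kappa sigma : sigma \in ichildren kappa ->
  above sigma = ustar kappa.
Proof.
rewrite /above; case E: (parent sigma) => [k|] sk.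
  exact: (child_uniq eT (ihead_child (parentP E)) (ihead_child sk)).
by move: E; rewrite /parent; case: pickP => // /(_ kappa); rewrite sk.
Qed.

Lemma descendant_le kappa k : connect (child_rel (K := K)) kappa k ->
  le (ihead k) (ihead kappa).
Proof.
case/connectP=> s + ->; elim: s kappa => [|l s IHs] kappa /= => [_|/andP[kl ls]].
  exact: tree_le_refl.
apply: (tree_le_trans eT (IHs _ ls) _).
exact: (tree_le_trans eT (child_le (ihead_child kl)) (upath_le (ustar_upath _))).
Qed.

Definition descendants (kappa : K) := [set k | connect (child_rel (K := K)) kappa k]%SET.

(** Makes the number of descendants a sufficient amount of fuel. The decrease is strict because
    heads get strictly deeper, so [kappa] is not a descendant of its own child. *)
Lemma card_descendants kappa sigma : sigma \in ichildren kappa ->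
  (#|descendants sigma| < #|descendants kappa|)%N.
Proof.
move=> sk; apply: proper_card; apply/properP; split.
  apply/fintype.subsetP=> k; rewrite !inE; apply: connect_trans.
  exact: connect1.
exists kappa; rewrite !inE ?connect0 //; apply/negP => /descendant_le ks.
have /negP := child_parentN eT (ihead_child sk); apply.
exact: (tree_le_trans eT (upath_le (ustar_upath _)) ks).
Qed.

(** * The law of the inverse transform of one distribution function *)

Section OneFunction.
Variables (R : realType) (mu : K -> R) (F : T -> R) (Q : T -> R).
Hypotheses (FE : forall x, F x = \sum_(z | le z x) Q z)
           (Q0 : forall x, 0 <= Q x)
           (muF : interlaced tau mu F).
Implicit Types (w t : R) (g : T -> R).

Lemma df_mono x y : le x y -> F x <= F y.
Proof.
move=> xy; rewrite !FE [leRHS](bigID (fun z => le z x)) /=.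
have -> : \sum_(z | le z y && le z x) Q z = \sum_(z | le z x) Q z.
  apply: eq_bigl => z; case: (boolP (le z x)); rewrite ?andbF // => zx.
  by rewrite (tree_le_trans eT zx xy).
by rewrite lerDl sumr_ge0.
Qed.

(** Descends while the level [w] stays below [F]. The starting vertex is not tested: in the
    application its value is [mu kappa], which exceeds [w]. *)
Fixpoint last_above (v : T) (s : seq T) w : T :=
  if s is v1 :: s' then if w < F v1 then last_above v1 s' w else v else v.

Lemma last_aboveP v s w : path (child e tau) v s -> w < F v ->
  let m := last_above v s w in
  [/\ m \in v :: s, w < F m & forall x, x \in v :: s -> w < F x -> le m x].
Proof.
elim: s v => [|v1 s IHs] v /= => [_|/andP[vv1 v1s]] wv.
  by split=> // [|x]; rewrite inE // => /eqP -> _; apply: tree_le_refl.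
case: ltrP => wv1; last first.
  split=> // [|x]; first exact: mem_head.
  rewrite inE => /predU1P[->|xs]; first by rewrite tree_le_refl.
  have /andP[_ xv1] := path_child_le v1s xs.
  by rewrite ltNge (le_trans (df_mono xv1)).
have [ms wm mle] := IHs v1 v1s wv1; split=> // [|x].
  by rewrite inE ms orbT.
rewrite inE => /predU1P[-> _|]; last exact: mle.
exact: (tree_le_trans eT (mle _ (mem_head _ _) wv1) (child_le vv1)).
Qed.

(** Below a parent index the vertex above lies outside [isub kappa], so it carries the value
    [mu kappa] and the set of candidates is not empty. At the root index there is no such vertex,
    and the head qualifies because [mu] and [F] agree there. Monotonicity of [F] allows the descent
    to stop at the first failure. *)
Lemma path_minE kappa w : w < mu kappa ->
  path_min e tau mu F kappa w = last_above (above kappa) (upath kappa) w.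
Proof.
move=> wmu; rewrite /path_min; set L := finset _; set m := last_above _ _ _.
suff [mL mle] : m \in L /\ forall x, x \in L -> le m x.
  case: pickP => [m' /andP[m'L /forall_inP m'le]|/(_ m)] /=.
    by apply: (tree_le_anti eT); [apply: m'le | apply: mle].
  by rewrite mL /= => /negbT/forall_inP[] x /mle.
have FindexE x : x \in upath kappa -> F_index mu F kappa x = F x.
  by move=> xk; rewrite /F_index upath_isub.
have uP := upath_child kappa.
rewrite /m {m} /L {L} /hat_upath /above; case E: (parent kappa) => [k|]; last first.
  have kr : kappa = iroot K.
    elim/index_ind: kappa E {wmu FindexE uP} => // k sigma sk _.
    by rewrite /parent; case: pickP => // /(_ k); rewrite sk.
  have wh : w < F (ihead kappa).
    by case: muF => muR _; rewrite kr (it_head_root KT) -muR -kr.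
  have [mu' wm mle] := last_aboveP uP wh.
  rewrite /upath /= wh; split; first by rewrite inE FindexE // wm andbT.
  by move=> x; rewrite inE => /andP[xk]; rewrite FindexE //; apply: mle.
have kh := ihead_child (parentP E).
have uN : ustar k \notin isub kappa by rewrite isubE inE (child_parentN eT).
have FuE : F_index mu F kappa (ustar k) = mu kappa by rewrite /F_index (negPf uN).
rewrite /upath /=; case: ltrP => wh.
  have [mu' wm mle] := last_aboveP uP wh; split.
    by rewrite inE in_cons mu' orbT FindexE // wm.
  move=> x; rewrite inE in_cons => /andP[/predU1P[-> _|xk]]; last first.
    by rewrite FindexE //; apply: mle.
  exact: (tree_le_trans eT (mle _ (mem_head _ _) wh) (child_le kh)).
split; first by rewrite inE mem_head FuE.
move=> x; rewrite inE in_cons => /andP[/predU1P[-> _|xk]].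
  exact: tree_le_refl.
by rewrite FindexE // ltNge (le_trans (df_mono (upath_le xk))).
Qed.

(** The steps over levels from [t] to [f0]: deeper vertices take lower levels, so the path appears
    in reverse. [f0] stands for the value at [v], which may be [mu kappa] instead of [F v]. *)
Fixpoint path_steps t f0 (v : T) (s : seq T) : seq (R * T) :=
  if s is v1 :: s' then rcons (path_steps t (F v1) v1 s') (f0 - F v1, v)
  else [:: (f0 - t, v)].

Lemma path_stepsP x0 t f0 v s :
  path (fun x y => y <= x) f0 (map F s) -> t <= last f0 (map F s) ->
  [/\ nonneg_steps (path_steps t f0 v s),
      step_length (path_steps t f0 v s) = f0 - t
    & forall w, t <= w < f0 ->
        step_fun x0 (path_steps t f0 v s) (w - t) = last_above v s w].
Proof.
elim: s f0 v => [|v1 s IHs] f0 v /= => [_ tf|/andP[f10 fs] tf].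
  split; rewrite ?subr_ge0 ?tf //.
    by rewrite /step_length big_seq1.
  by move=> w /andP[tw wf]; rewrite ltrD2r wf.
have [nn len stepE] := IHs (F v1) v1 fs tf.
rewrite -cats1; split.
- by rewrite /nonneg_steps all_cat; apply/andP; rewrite /= subr_ge0 f10.
- by rewrite step_length_cat len /step_length big_seq1 /= addrC subrKA.
move=> w /andP[tw wf]; case: ltrP => wv1.
  by rewrite step_fun_catl ?stepE ?tw ?len ?subr_ge0 ?tw ?ltrD2r.
rewrite step_fun_catr //; last by rewrite len lerD2r.
by rewrite len /= ifT //; lra.
Qed.

Definition subtree_int g x : R := \sum_(z | le z x) Q z * g z.

Lemma subtree_intE g x :
  subtree_int g x = Q x * g x + \sum_(y in succ x) subtree_int g y.
Proof. exact: (sum_subtree eT (fun z => Q z * g z)). Qed.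

Lemma df_rec x : F x = Q x + \sum_(y in succ x) F y.
Proof. by rewrite FE (sum_subtree eT); under eq_bigr do rewrite -FE. Qed.

(** An inner vertex has a single successor, so its step has length [F v - F v1 = Q v]. [C] is the
    integral already produced by the child indices below level [t]; the last hypothesis says that it
    completes the subtree of the last vertex. *)
Lemma path_steps_sum t v s g C : path (child e tau) v s ->
  {in belast v s, forall x, #|succ x| = 1%N} ->
  (F (last v s) - t) * g (last v s) + C = subtree_int g (last v s) ->
  step_sum (path_steps t (F v) v s) g + C = subtree_int g v.
Proof.
elim: s v => [|v1 s IHs] v /= => [_ _ <-|/andP[vv1 v1s] one lastE].
  by rewrite /step_sum big_seq1.
have succE : succ v = [set v1]%SET.
  have /eqP/cards1P[y yE] := one v (mem_head _ _).
  have : v1 \in succ v by rewrite in_successors inE.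
  by rewrite yE inE => /eqP ->.
rewrite -cats1 step_sum_cat [step_sum [:: _] g]big_seq1 /= addrAC.
rewrite IHs // => [|x xs]; last by apply: one; rewrite inE xs orbT.
by rewrite (subtree_intE g v) (df_rec v) succE !big_set1; lra.
Qed.

Lemma child_sum0 kappa : child_sum mu kappa 0 = 0.
Proof. by rewrite /child_sum take0 big_nil. Qed.

Lemma child_sumS kappa (j : nat) : (j < size (ichildren kappa))%N ->
  child_sum mu kappa j.+1 =
  child_sum mu kappa j + mu (nth kappa (ichildren kappa) j).
Proof.
by move=> jk; rewrite /child_sum (take_nth kappa) // -cats1 big_cat big_seq1.
Qed.

Lemma child_sum_interval kappa w : 0 <= w < mu_minus mu kappa ->
  exists j : 'I_(size (ichildren kappa)),
    child_sum mu kappa j <= w < child_sum mu kappa j.+1.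
Proof.
move=> /andP[w0 wk]; pose below j := w < child_sum mu kappa j.
have below_size : below (size (ichildren kappa)).
  by rewrite /below /child_sum take_size.
(* The least partial sum above [w] is not the empty one; the interval sought ends there, hence the
   predecessor. *)
case: (ex_minnP (ex_intro below _ below_size)) => -[|j] wj jmin.
  by move: wj; rewrite /below child_sum0 ltNge w0.
exists (Ordinal (jmin _ below_size)) => /=; rewrite [w < _]wj andbT leNgt.
by apply/negP => /jmin; rewrite ltnn.
Qed.

(** The term with [above kappa] is the overflow: the interval of [kappa] is longer than the mass of
    its subtree, and the excess is given to the vertex above. At the parent, the overflows of all
    children together with the interval from [mu_minus mu kappa] to [F (ustar kappa)] have total
    length exactly [Q (ustar kappa)], which closes the induction. *)
Lemma inverse_transform_rec_steps n kappa : (#|descendants kappa| <= n)%N ->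
  exists s, [/\ nonneg_steps s, step_length s = mu kappa,
    forall w, 0 <= w < mu kappa ->
      inverse_transform_rec e tau n mu F kappa w = step_fun tau s w
  & forall g, step_sum s g = subtree_int g (ihead kappa) +
                (mu kappa - F (ihead kappa)) * g (above kappa)].
Proof.
elim: n kappa => [|n IHn] kappa kn.
  by move: kn; rewrite leqn0 cards_eq0 => /eqP/setP/(_ kappa); rewrite !inE connect0.
have /choice[sf sfP] : forall sigma, exists s, sigma \in ichildren kappa ->
  [/\ nonneg_steps s, step_length s = mu sigma,
    forall w, 0 <= w < mu sigma ->
      inverse_transform_rec e tau n mu F sigma w = step_fun tau s w
  & forall g, step_sum s g = subtree_int g (ihead sigma) +
                (mu sigma - F (ihead sigma)) * g (ustar kappa)].
  move=> sigma; have [sk|] := boolP (sigma \in ichildren kappa); last by exists [::].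
  have [|s] := IHn sigma.
    by rewrite -ltnS (leq_trans (card_descendants sk)).
  by rewrite (above_child sk); exists s.
pose fl C := flatten [seq sf sigma | sigma <- C].
have flP C : {subset C <= ichildren kappa} ->
    nonneg_steps (fl C) /\ step_length (fl C) = \sum_(sigma <- C) mu sigma.
  elim: C => [|sigma C IHC] sub; first by rewrite /step_length !big_nil.
  have [|nnC lenC] := IHC; first by move=> x xC; apply: sub; rewrite inE xC orbT.
  have [nn len _ _] := sfP sigma (sub _ (mem_head _ _)).
  rewrite /fl /= step_length_cat -/(fl C) lenC len big_cons; split=> //.
  by rewrite /nonneg_steps all_cat; apply/andP.
have [nnfl lenfl] := flP _ (fun x => id : x \in ichildren kappa -> _).
have [_ /(_ kappa)[muu uh hmu]] := muF.
set t := mu_minus mu kappa in muu.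
have Fpath : path (fun x y => y <= x) (mu kappa) (map F (upath kappa)).
  rewrite /= hmu /=; elim: (itail kappa) (ihead kappa) (upath_child kappa) => //=.
  by move=> v s IHs u /andP[uv vs]; rewrite df_mono ?IHs // (child_le uv).
have [|nnp lenp stepp] := path_stepsP tau (above kappa) Fpath (t := t).
  by rewrite /= last_map.
set ps := path_steps _ _ _ _ in nnp lenp stepp.
exists (fl (ichildren kappa) ++ ps); split.
- by rewrite /nonneg_steps all_cat; apply/andP.
- by rewrite step_length_cat lenfl lenp -/(mu_minus mu kappa) -/t addrC subrK.
- move=> w /andP[w0 wmu] /=; case: ltrP => wt; last first.
    rewrite path_minE // step_fun_catr ?lenfl //.
    by rewrite -/(mu_minus mu kappa) -/t stepp ?wt.
  case: pickP => [j /andP[jw wj]|none]; last first.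
    have [|j] := @child_sum_interval kappa w; first by rewrite w0.
    by rewrite none.
  set C := ichildren kappa; set sigma := nth kappa C j.
  have jC : (j < size C)%N := ltn_ord j.
  have sC : sigma \in C by apply: mem_nth.
  have CE : C = take j C ++ sigma :: drop j.+1 C.
    by rewrite -drop_nth // cat_take_drop.
  have [nn len stepE _] := sfP sigma sC.
  have [|nnt lent] := flP (take j C); first by move=> x /mem_take.
  have flE : fl C = fl (take j C) ++ sf sigma ++ fl (drop j.+1 C).
    by rewrite {1}CE /fl map_cat flatten_cat.
  have ws : 0 <= w - child_sum mu kappa j < mu sigma.
    by rewrite subr_ge0 jw ltrBlDl -child_sumS.
  rewrite stepE // flE -!catA step_fun_catr ?lent //.
  by rewrite step_fun_catl ?len.
- move=> g; rewrite step_sum_cat.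
  have -> : step_sum (fl (ichildren kappa)) g =
      \sum_(y in succ (ustar kappa)) subtree_int g y +
      (t - \sum_(y in succ (ustar kappa)) F y) * g (ustar kappa).
    rewrite -!sum_children /t /mu_minus.
    rewrite -sumrB mulr_suml -big_split /=.
    rewrite /step_sum /fl big_flatten big_map /=.
    by apply: eq_big_seq => sigma /sfP[_ _ _]; apply.
  rewrite /ps /upath /= -cats1 step_sum_cat [step_sum [:: _] g]big_seq1 /=.
  rewrite addrA; congr (_ + _); rewrite addrC; apply: path_steps_sum.
  + exact: upath_child.
  + move=> x xk; rewrite -(@successors_isub kappa) ?(it_inner KT) //.
    exact: mem_belast.
  + by rewrite -/(ustar kappa) subtree_intE df_rec; lra.
Qed.

(** At the root index the overflow vanishes since [mu] equals [F tau] there, and [#|K|] is enough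
    fuel since it bounds the number of descendants. *)
Lemma inverse_transform_steps :
  exists s, [/\ nonneg_steps s, step_length s = F tau,
    forall w, 0 <= w < F tau -> inverse_transform e tau mu F w = step_fun tau s w
  & forall g, step_sum s g = \sum_z Q z * g z].
Proof.
have [s [nn len stepE sumE]] :=
  inverse_transform_rec_steps (max_card (descendants (iroot K))).
have [muR _] := muF; rewrite -muR; exists s; split=> // g.
rewrite sumE (it_head_root KT) muR subrr mul0r addr0.
by apply: eq_bigl => z; rewrite tree_le_root.
Qed.

End OneFunction.
End IndexTreeTheory.

(** * Pointwise comparison of two inverse transforms *)

Section Comparison.
Variables (disp : Order.disp_t) (S : finPOrderType disp).
Variables (e : rel S) (tau : S) (K : index_data S).
Hypotheses (eT : rooted_tree e tau) (KT : index_tree K e tau).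
Variables (R : realType) (mu : K -> R) (F1 F2 Q1 Q2 : S -> R).
Hypotheses (F1E : forall x, F1 x = \sum_(z | tree_le e tau z x) Q1 z)
           (F2E : forall x, F2 x = \sum_(z | tree_le e tau z x) Q2 z)
           (Q1_ge0 : forall x, 0 <= Q1 x) (Q2_ge0 : forall x, 0 <= Q2 x)
           (muF1 : interlaced tau mu F1) (muF2 : interlaced tau mu F2)
           (cmp : forall x y, child e tau x y ->
              (x < y)%O /\ F1 y <= F2 y \/ (y < x)%O /\ F2 y <= F1 y).

Lemma last_above_stop (F : S -> R) v s w :
  path (fun x y => F y <= F x) v s -> F v <= w -> last_above F v s w = v.
Proof. by case: s => //= v1 s /andP[v1v _] vw; rewrite ltNge (le_trans v1v vw). Qed.

Lemma last_above_le v s w : path (child e tau) v s ->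
  (last_above F1 v s w <= last_above F2 v s w)%O.
Proof.
have mono (F Q : S -> R) : (forall x, F x = \sum_(z | tree_le e tau z x) Q z) ->
    (forall x, 0 <= Q x) -> forall u r, path (child e tau) u r ->
    path (fun x y => F y <= F x) u r.
  by move=> FE Q0 u r; apply: sub_path => x y /child_le; apply: (df_mono eT FE Q0).
elim: s v => //= v1 s IHs v /andP[vv1 v1s].
have := cmp vv1; have le12 := IHs v1 v1s.
case: ltrP => w1; case: ltrP => w2 //.
  (* Only the first walk descends. Restarted at [v1], the second one stops there at once, so the
     induction hypothesis bounds the first walk by [v1], and [F2 v1 <= w < F1 v1] forces [v1 < v].
     The other mixed case is symmetric. *)
  rewrite (last_above_stop (mono _ _ F2E Q2_ge0 _ _ v1s) w2) in le12.
  case=> -[vv1' F12]; last exact: le_trans le12 (ltW vv1').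
  by move: (lt_le_trans w1 F12); rewrite ltNge w2.
rewrite (last_above_stop (mono _ _ F1E Q1_ge0 _ _ v1s) w1) in le12.
case=> -[vv1' F12]; first exact: le_trans (ltW vv1') le12.
by move: (lt_le_trans w2 F12); rewrite ltNge w1.
Qed.

Lemma path_min_le kappa w : w < mu kappa ->
  (path_min e tau mu F1 kappa w <= path_min e tau mu F2 kappa w)%O.
Proof.
move=> wmu; rewrite (path_minE eT KT F1E) // (path_minE eT KT F2E) //.
case E: (parent kappa) => [k|].
  apply: last_above_le; rewrite /above E /= (upath_child KT) andbT.
  exact: (ihead_child KT (parentP E)).
have kr : kappa = iroot K.
  elim/(index_ind KT): kappa E {wmu} => // k sigma sk _.
  by rewrite /parent; case: pickP => // /(_ k); rewrite sk.
have [[muR1 _] [muR2 _]] := (muF1, muF2).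
have hr : ihead kappa = tau by rewrite kr (it_head_root KT).
rewrite /upath /= hr -muR1 -muR2 -kr wmu; apply: last_above_le.
by move: (upath_child KT kappa); rewrite hr.
Qed.

Lemma inverse_transform_le w : w < mu (iroot K) ->
  (inverse_transform e tau mu F1 w <= inverse_transform e tau mu F2 w)%O.
Proof.
rewrite /inverse_transform; move: #|K| => n.
elim: n (iroot K) w => // n IHn kappa w wmu /=.
case: ifP => _; last exact: path_min_le.
case: pickP => // j /andP[_]; rewrite child_sumS ?ltn_ord // => wj.
by apply: IHn; rewrite ltrBlDl.
Qed.

End Comparison.

(** * Glued diamonds *)

Section PosetGluing.
Variables (disp : Order.disp_t) (S : finPOrderType disp).
Implicit Types (D U V : {set S}) (x y z : S).

Lemma hasse_mem V x y : hasse V x y -> [/\ x \in V, y \in V & (x < y)%O].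
Proof. by case/and4P. Qed.

Lemma undirected_mem V x y :
  undirected (hasse V) x y -> x \in V /\ y \in V.
Proof. by case/orP=> /hasse_mem[]. Qed.

Lemma undirected_sym (r : rel S) : symmetric (undirected r).
Proof. by move=> x y; rewrite /undirected orbC. Qed.

Lemma hasseTP x y : (x < y)%O -> ~~ hasse [set: S]%SET x y ->
  exists2 z, (x < z)%O & (z < y)%O.
Proof.
move=> xy; rewrite /hasse !inE xy /= => /forall_inPn[z _].
by rewrite negbK => /andP[xz zy]; exists z.
Qed.

(** Closure under covers suffices by finiteness: induction on the number of elements strictly
    between [x] and [y]. *)
Lemma up_set_hasse U :
  (forall x y, x \in U -> hasse [set: S]%SET x y -> y \in U) -> up_set U.
Proof.
move=> UH x y xU; rewrite le_eqVlt => /predU1P[<- //|].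
have [n] := ubnP #|[set z | (x < z)%O && (z < y)%O]%SET|.
elim: n x y xU => // n IHn x y xU; rewrite ltnS => xyn xy.
have [/UH|] := boolP (hasse [set: S]%SET x y); first exact.
case/(hasseTP xy) => z xz zy.
have sub u v : ([set w | (u < w)%O && (w < v)%O] \proper
    [set w | (x < w)%O && (w < y)%O])%SET -> u \in U -> (u < v)%O -> v \in U.
  by move=> /proper_card uv uU; apply: IHn => //; apply: leq_trans uv xyn.
have zU : z \in U.
  apply: (sub x z) => //; apply/properP; split.
    by apply/fintype.subsetP=> w; rewrite !inE => /andP[-> /lt_trans->].
  by exists z; rewrite !inE ?xz ?zy // ltxx andbF.
apply: (sub z y) => //; apply/properP; split.
  by apply/fintype.subsetP=> w; rewrite !inE => /andP[/(lt_trans xz)->].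
by exists z; rewrite !inE ?xz ?zy // ltxx.
Qed.

(** When [v < d] is the only relation between the two sets, no element of one can lie between two
    elements of the other, and the Hasse diagrams are joined by a single edge. *)
Lemma hasse_union V1 V2 (v d : S) : v \in V1 -> d \in V2 -> (v < d)%O ->
  (forall x y, x \in V1 -> y \in V2 -> (x < y)%O -> x = v /\ y = d) ->
  (forall x y, x \in V2 -> y \in V1 -> ~~ (x < y)%O) ->
  hasse (V1 :|: V2)%SET =2
    fun x y => [|| hasse V1 x y, hasse V2 x y | (x == v) && (y == d)].
Proof.
move=> vV dV vd up down x y; apply/idP/or3P.
  case/and4P; rewrite !finset.in_setU => xD yD xy /forall_inP noz.
  case/orP: xD => xV; case/orP: yD => yV.
  - by constructor 1; rewrite /hasse xV yV xy; apply/forall_inP=> z zV;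
      apply: noz; rewrite finset.in_setU zV.
  - by have [-> ->] := up x y xV yV xy; constructor 3; rewrite !eqxx.
  - by have := down x y xV yV; rewrite xy.
  - by constructor 2; rewrite /hasse xV yV xy; apply/forall_inP=> z zV;
      apply: noz; rewrite finset.in_setU zV orbT.
case=> [/and4P[xV yV xy /forall_inP noz]|/and4P[xV yV xy /forall_inP noz]|].
- rewrite /hasse !finset.in_setU xV yV xy; apply/forall_inP=> z.
  rewrite finset.in_setU => /orP[/noz //|zV].
  by rewrite negb_and (down z y zV yV) orbT.
- rewrite /hasse !finset.in_setU xV yV xy !orbT; apply/forall_inP=> z.
  rewrite finset.in_setU => /orP[zV|/noz //].
  by rewrite negb_and (down x z xV zV).
- case/andP=> /eqP -> /eqP ->; rewrite /hasse !finset.in_setU vV dV vd orbT.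
  apply/forall_inP=> z; rewrite finset.in_setU => /orP[zV|zV]; apply/negP.
    by case/andP=> vz zd; have [zE _] := up z d zV dV zd; rewrite zE ltxx in vz.
  by case/andP=> vz zd; have [_ zE] := up v z vV zV vz; rewrite zE ltxx in zd.
Qed.

End PosetGluing.

(** * The pieces of a glued diamond and its covering relations *)

Section WGluedDiamondTheory.
Variables (disp : Order.disp_t) (S : finPOrderType disp) (G : glue_data S).
Hypothesis WG : W_glued_diamond G.
Local Notation a := (ga G).
Local Notation b := (gb G).
Local Notation c := (gc G).
Local Notation d := (gd G).
Implicit Types (x y z : S) (U V : {set S}) (p : seq S).

Lemma a_lt_b : (a < b)%O. Proof. by have [] := wgd_diamond WG. Qed.
Lemma a_lt_c : (a < c)%O. Proof. by have [] := wgd_diamond WG. Qed.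
Lemma b_lt_d : (b < d)%O. Proof. by have [] := wgd_diamond WG. Qed.
Lemma c_lt_d : (c < d)%O. Proof. by have [] := wgd_diamond WG. Qed.
Lemma a_lt_d : (a < d)%O. Proof. exact: lt_trans a_lt_b b_lt_d. Qed.

Lemma a_Wa : a \in Wa G. Proof. by have [[]] := wgd_extremal WG. Qed.
Lemma b_Wb : b \in Wb G. Proof. by have [_ []] := wgd_extremal WG. Qed.
Lemma c_Wc : c \in Wc G. Proof. by have [_ _ []] := wgd_extremal WG. Qed.
Lemma d_Wd : d \in Wd G. Proof. by have [_ _ _ []] := wgd_extremal WG. Qed.

Lemma Wa_a x : x \in Wa G -> (x < a)%O = false.
Proof. by have [[_ H] _ _ _] := wgd_extremal WG => /H/negbTE. Qed.
Lemma Wb_b x : x \in Wb G -> (x < b)%O = false.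
Proof. by have [_ [_ H] _ _] := wgd_extremal WG => /H/negbTE. Qed.
Lemma Wc_c x : x \in Wc G -> (x < c)%O = false.
Proof. by have [_ _ [_ H] _] := wgd_extremal WG => /H/negbTE. Qed.
Lemma Wd_d x : x \in Wd G -> (d < x)%O = false.
Proof. by have [_ _ _ [_ H]] := wgd_extremal WG => /H/negbTE. Qed.

Lemma in_Wa x : x \in Wa G ->
  ((x \in Wb G = false) * (x \in Wc G = false) * (x \in Wd G = false)) *
  ((x == b = false) * (x == c = false) * (x == d = false)).
Proof.
have [[ab ac ad] _] := wgd_disjoint WG => xa.
have xb := disjointFr ab xa.
have xc := disjointFr ac xa.
have xd := disjointFr ad xa.
rewrite xb xc xd; do !split=> //; apply/eqP => xE; move: xb xc xd;
  by rewrite xE ?b_Wb ?c_Wc ?d_Wd.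
Qed.

Lemma in_Wb x : x \in Wb G ->
  ((x \in Wa G = false) * (x \in Wc G = false) * (x \in Wd G = false)) *
  ((x == a = false) * (x == c = false) * (x == d = false)).
Proof.
have [[ab _ _] [bc bd _]] := wgd_disjoint WG => xb.
have xa := disjointFl ab xb.
have xc := disjointFr bc xb.
have xd := disjointFr bd xb.
rewrite xa xc xd; do !split=> //; apply/eqP => xE; move: xa xc xd;
  by rewrite xE ?a_Wa ?c_Wc ?d_Wd.
Qed.

Lemma in_Wc x : x \in Wc G ->
  ((x \in Wa G = false) * (x \in Wb G = false) * (x \in Wd G = false)) *
  ((x == a = false) * (x == b = false) * (x == d = false)).
Proof.
have [[_ ac _] [bc _ cd]] := wgd_disjoint WG => xc.
have xa := disjointFl ac xc.
have xb := disjointFl bc xc.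
have xd := disjointFr cd xc.
rewrite xa xb xd; do !split=> //; apply/eqP => xE; move: xa xb xd;
  by rewrite xE ?a_Wa ?b_Wb ?d_Wd.
Qed.

Lemma in_Wd x : x \in Wd G ->
  ((x \in Wa G = false) * (x \in Wb G = false) * (x \in Wc G = false)) *
  ((x == a = false) * (x == b = false) * (x == c = false)).
Proof.
have [[_ _ ad] [_ bd cd]] := wgd_disjoint WG => xd.
have xa := disjointFl ad xd.
have xb := disjointFl bd xd.
have xc := disjointFl cd xd.
rewrite xa xb xc; do !split=> //; apply/eqP => xE; move: xa xb xc;
  by rewrite xE ?a_Wa ?b_Wb ?c_Wc.
Qed.

Variant piece_spec x : Prop :=
  | PieceA of x \in Wa G | PieceB of x \in Wb G
  | PieceC of x \in Wc G | PieceD of x \in Wd G.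

Lemma pieceP x : piece_spec x.
Proof.
have : x \in [set: S]%SET by rewrite inE.
rewrite -(wgd_cover WG) !finset.in_setU -!orbA.
by case/or4P; [constructor 1 | constructor 2 | constructor 3 | constructor 4].
Qed.

Variant cover_spec x y : Prop :=
  | CoverA of hasse (Wa G) x y | CoverB of hasse (Wb G) x y
  | CoverC of hasse (Wc G) x y | CoverD of hasse (Wd G) x y
  | CoverAB of x = a & y = b | CoverAC of x = a & y = c
  | CoverBD of x = b & y = d | CoverCD of x = c & y = d.

Lemma coverP x y : hasse [set: S]%SET x y -> cover_spec x y.
Proof.
rewrite (wgd_hasse WG) /glued_hasse /= orbF.
case/orP=> [/and4P[xG yG xy /forall_inP noz]|/or4P[]]; last first.
- by constructor 4.
- by constructor 3.
- by constructor 2.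
- by constructor 1.
have [ab bd ac cd] := wgd_diamond WG; rewrite /Order.comparable => bc.
have ad := lt_trans ab bd.
(* The relation [a < d] holds in the diamond but is not a cover, because [b] lies between. *)
have bG : b \in diamond G by rewrite !inE eqxx orbT.
have := noz b bG; move: xG yG xy; rewrite !inE -!orbA.
case/or4P=> /eqP ->; case/or4P=> /eqP ->; rewrite ?ltxx //.
all: try by constructor.
all: try by rewrite (lt_gtF ab).
all: try by rewrite (lt_gtF ac).
all: try by rewrite (lt_gtF bd).
all: try by rewrite (lt_gtF cd).
all: try by rewrite (lt_gtF ad).
all: try by rewrite ab bd.
all: try by move/ltW=> bc'; rewrite bc' ?orbT in bc.
Qed.


(** * Up-sets and down-sets assembled from the pieces *)

Lemma up_set_pieces U :
  (forall x y, x \in Wa G -> y \in Wa G -> y == a = false -> (x < y)%O ->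
    hasse (Wa G) x y -> x \in U -> y \in U) ->
  (forall x y, x \in Wb G -> y \in Wb G -> y == b = false -> (x < y)%O ->
    hasse (Wb G) x y -> x \in U -> y \in U) ->
  (forall x y, x \in Wc G -> y \in Wc G -> y == c = false -> (x < y)%O ->
    hasse (Wc G) x y -> x \in U -> y \in U) ->
  (forall x y, x \in Wd G -> y \in Wd G -> x == d = false -> (x < y)%O ->
    hasse (Wd G) x y -> x \in U -> y \in U) ->
  (a \in U -> b \in U) -> (a \in U -> c \in U) ->
  (b \in U -> d \in U) -> (c \in U -> d \in U) ->
  up_set U.
Proof.
move=> UA UB UC UD ab ac bd cd; apply: up_set_hasse => x y + /coverP.
move=> xU [] => [xy|xy|xy|xy|xE ->|xE ->|xE ->|xE ->]; rewrite -?xE in ab ac bd cd *;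
  try (by [apply: ab | apply: ac | apply: bd | apply: cd]).
all: move: xU; have [xV yV xlty] := hasse_mem xy.
- apply: UA => //; apply/eqP => yE; by rewrite yE Wa_a in xlty.
- apply: UB => //; apply/eqP => yE; by rewrite yE Wb_b in xlty.
- apply: UC => //; apply/eqP => yE; by rewrite yE Wc_c in xlty.
- apply: UD => //; apply/eqP => xE; by rewrite xE Wd_d in xlty.
Qed.

Let diamondE := (in_Wa a_Wa, in_Wb b_Wb, in_Wc c_Wc, in_Wd d_Wd,
  a_Wa, b_Wb, c_Wc, d_Wd, eqxx, orbT, orbF).

Lemma up_set_Wd : up_set (Wd G).
Proof.
apply: up_set_pieces; rewrite ?diamondE // => x y xV yV _ _ _.
- by rewrite (in_Wa xV).
- by rewrite (in_Wb xV).
- by rewrite (in_Wc xV).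
Qed.

Lemma up_set_Wa : up_set (Wa G :\ a)%SET.
Proof.
apply: up_set_pieces; rewrite ?inE ?diamondE // => x y xV yV xyE _ _.
- by rewrite !inE xyE yV.
- by rewrite !inE !(in_Wb xV) andbF.
- by rewrite !inE !(in_Wc xV) andbF.
- by rewrite !inE !(in_Wd xV) andbF.
Qed.

Lemma up_set_Wb : up_set (Wb G :\ b)%SET.
Proof.
apply: up_set_pieces; rewrite ?inE ?diamondE // => x y xV yV xyE _ _.
- by rewrite !inE !(in_Wa xV) andbF.
- by rewrite !inE xyE yV.
- by rewrite !inE !(in_Wc xV) andbF.
- by rewrite !inE !(in_Wd xV) andbF.
Qed.

Lemma up_set_Wc : up_set (Wc G :\ c)%SET.
Proof.
apply: up_set_pieces; rewrite ?inE ?diamondE // => x y xV yV xyE _ _.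
- by rewrite !inE !(in_Wa xV) andbF.
- by rewrite !inE !(in_Wb xV) andbF.
- by rewrite !inE xyE yV.
- by rewrite !inE !(in_Wd xV) andbF.
Qed.

Lemma up_set_setCWd : up_set (~: (Wd G :\ d))%SET.
Proof.
apply: up_set_pieces; rewrite ?inE ?diamondE // => x y xV yV xyE _ _.
- by rewrite !inE !(in_Wa yV) andbF.
- by rewrite !inE !(in_Wb yV) andbF.
- by rewrite !inE !(in_Wc yV) andbF.
- by rewrite !inE xyE xV.
Qed.

Lemma up_set_setC_low U (B C : bool) : a \in U ->
  (forall x y, x \in Wa G -> y \in Wa G -> (x < y)%O -> y \in U -> x \in U) ->
  (forall x, x \in Wb G -> (x \in U) = B) ->
  (forall x, x \in Wc G -> (x \in U) = C) ->
  (forall x, x \in Wd G -> x \notin U) ->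
  up_set (~: U)%SET.
Proof.
move=> aU UA UB UC UD; apply: up_set_pieces;
  rewrite ?finset.in_setC ?aU ?(UD d d_Wd) // => x y xV yV _ xy _;
  rewrite !finset.in_setC.
- by apply: contra; apply: UA.
- by rewrite !UB.
- by rewrite !UC.
- by rewrite !UD.
Qed.

(** The down-sets behind the choice of [q'] and [q'']. Taking [[set a]] for [A] serves nonnegativity
    at [a], and [Wa] the comparison on the edge from [d] to [a]. *)
Lemma low_up_sets (A : {set S}) : A = [set a]%SET \/ A = Wa G ->
  [/\ up_set (~: A)%SET, up_set (~: (A :|: Wb G))%SET,
      up_set (~: (A :|: Wc G))%SET & up_set (~: (A :|: (Wb G :|: Wc G)))%SET].
Proof.
move=> AE.
have aA : a \in A by case: AE => ->; rewrite ?inE ?a_Wa.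
have AA x y : x \in Wa G -> y \in Wa G -> (x < y)%O -> y \in A -> x \in A.
  move=> xa ya xy; case: AE => -> //; rewrite !inE => /eqP yE.
  by rewrite yE Wa_a in xy.
have AN x : x \in Wb G \/ x \in Wc G \/ x \in Wd G -> x \in A = false.
  by case: AE => -> [xV|[xV|xV]]; rewrite ?inE ?(in_Wb xV) ?(in_Wc xV) ?(in_Wd xV).
have key U (B C : bool) :
    (forall x, (x \in U) = (x \in A) || (x \in Wb G) && B || (x \in Wc G) && C) ->
    up_set (~: U)%SET.
  move=> UE; apply: (@up_set_setC_low U B C) => [|x y xV yV xy|x xV|x xV|x xV].
  - by rewrite UE aA.
  - rewrite !UE !(in_Wa xV) !(in_Wa yV) !orbF; exact: AA.
  - by rewrite UE AN ?xV ?(in_Wb xV) ?orbF; [|left].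
  - by rewrite UE AN ?xV ?(in_Wc xV); [|right; left].
  - by rewrite UE AN ?(in_Wd xV); [|right; right].
split.
- by apply: (key A false false) => x; rewrite !andbF !orbF.
- by apply: (key _ true false) => x; rewrite !inE andbT andbF orbF.
- by apply: (key _ false true) => x; rewrite !inE andbT andbF orbF.
- by apply: (key _ true true) => x; rewrite !inE !andbT orbA.
Qed.

(** * Hasse diagrams of the three glued subposets and the edges of the tree *)

Lemma hatWb_hasse :
  hasse (hatWb G) =2 fun x y => hasse (Wb G) x y || (x == b) && (y == d).
Proof.
move=> x y; rewrite /hatWb finset.setUC (@hasse_union _ _ _ _ b d) ?b_Wb ?b_lt_d //.
- have -> : hasse [set d]%SET x y = false; last by [].
  by apply/negP => /hasse_mem[]; rewrite !inE => /eqP -> /eqP ->; rewrite ltxx.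
- by rewrite inE.
- move=> {x y} x y xV; rewrite inE => /eqP -> xd; split=> //.
  apply/eqP; apply: contraTT xd => xNb; apply/negP => xd.
  have /up_set_Wb/(_ (ltW xd)) : x \in (Wb G :\ b)%SET by rewrite !inE xNb.
  by rewrite !inE !diamondE andbF.
- move=> {x y} x y; rewrite inE => /eqP -> yV; apply/negP => /ltW.
  by move/(up_set_Wd d_Wd); rewrite (in_Wb yV).
Qed.

Lemma hatWc_hasse :
  hasse (hatWc G) =2 fun x y => hasse (Wc G) x y || (x == c) && (y == d).
Proof.
move=> x y; rewrite /hatWc finset.setUC (@hasse_union _ _ _ _ c d) ?c_Wc ?c_lt_d //.
- have -> : hasse [set d]%SET x y = false; last by [].
  by apply/negP => /hasse_mem[]; rewrite !inE => /eqP -> /eqP ->; rewrite ltxx.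
- by rewrite inE.
- move=> {x y} x y xV; rewrite inE => /eqP -> xd; split=> //.
  apply/eqP; apply: contraTT xd => xNc; apply/negP => xd.
  have /up_set_Wc/(_ (ltW xd)) : x \in (Wc G :\ c)%SET by rewrite !inE xNc.
  by rewrite !inE !diamondE andbF.
- move=> {x y} x y; rewrite inE => /eqP -> yV; apply/negP => /ltW.
  by move/(up_set_Wd d_Wd); rewrite (in_Wc yV).
Qed.

Lemma Wprime_hasse : hasse (Wprime G) =2
  fun x y => [|| hasse (Wa G) x y, hasse (Wd G) x y | (x == a) && (y == d)].
Proof.
move=> x y; rewrite (@hasse_union _ _ _ _ a d) ?a_Wa ?d_Wd ?a_lt_d //.
  move=> {x y} x y xV yV xy; split; apply/eqP.
    apply: contraTT xy => xNa; apply/negP => xy.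
    have /up_set_Wa/(_ (ltW xy)) : x \in (Wa G :\ a)%SET by rewrite !inE xNa.
    by rewrite !inE !(in_Wd yV) andbF.
  apply: contraTT xy => yNd; apply/negP => xy.
  have /up_set_setCWd/(_ (ltW xy)) : x \in (~: (Wd G :\ d))%SET.
    by rewrite !inE !(in_Wa xV).
  by rewrite !inE yNd yV.
move=> {x y} x y xV yV; apply/negP => /ltW/(up_set_Wd xV).
by rewrite (in_Wa yV).
Qed.

(** Compared with the Hasse diagram of [S], the edges from [a] to [b] and [c] are gone and one from
    [a] to [d] has appeared. *)
Lemma W_treeE x y : W_tree G x y =
  [|| undirected (hasse (Wa G)) x y, undirected (hasse (Wb G)) x y,
      undirected (hasse (Wc G)) x y, undirected (hasse (Wd G)) x y,
      (y == d) && (x \in [set a; b; c]%SET) |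
      (x == d) && (y \in [set a; b; c]%SET)].
Proof.
rewrite /W_tree /undirected /glued_hasse /=.
rewrite !hatWb_hasse !hatWc_hasse !Wprime_hasse !inE !orbF.
case: (hasse (Wa G) x y) (hasse (Wb G) x y) (hasse (Wc G) x y) => [] [] [] /=;
  rewrite ?orbT //.
case: (hasse (Wa G) y x) (hasse (Wb G) y x) (hasse (Wc G) y x) => [] [] [] /=;
  rewrite ?orbT //.
case: (hasse (Wd G) x y) (hasse (Wd G) y x) => [] [] /=; rewrite ?orbT //.
rewrite ![(_ == d) && _]andbC !andb_orl -!orbA.
by do !bool_congr; rewrite orbC -!orbA; do !bool_congr.
Qed.

Lemma undirected_notin V x y : x \notin V -> undirected (hasse V) x y = false.
Proof. by move=> xV; apply/negP => /undirected_mem[]; rewrite (negPf xV). Qed.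

Lemma W_tree_Wa x y : x \in Wa G -> y != d -> W_tree G x y ->
  undirected (hasse (Wa G)) x y.
Proof.
move=> xV yd; rewrite W_treeE (negPf yd) !(in_Wa xV)
  (@undirected_notin (Wb G)) ?(in_Wa xV) //
  (@undirected_notin (Wc G)) ?(in_Wa xV) //
  (@undirected_notin (Wd G)) ?(in_Wa xV) //.
by rewrite /= ?orbF.
Qed.

Lemma W_tree_Wb x y : x \in Wb G -> y != d -> W_tree G x y ->
  undirected (hasse (Wb G)) x y.
Proof.
move=> xV yd; rewrite W_treeE (negPf yd) !(in_Wb xV)
  (@undirected_notin (Wa G)) ?(in_Wb xV) //
  (@undirected_notin (Wc G)) ?(in_Wb xV) //
  (@undirected_notin (Wd G)) ?(in_Wb xV) //.
by rewrite /= ?orbF.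
Qed.

Lemma W_tree_Wc x y : x \in Wc G -> y != d -> W_tree G x y ->
  undirected (hasse (Wc G)) x y.
Proof.
move=> xV yd; rewrite W_treeE (negPf yd) !(in_Wc xV)
  (@undirected_notin (Wa G)) ?(in_Wc xV) //
  (@undirected_notin (Wb G)) ?(in_Wc xV) //
  (@undirected_notin (Wd G)) ?(in_Wc xV) //.
by rewrite /= ?orbF.
Qed.

Lemma W_tree_Wd x y : x \in Wd G -> x != d -> W_tree G x y ->
  undirected (hasse (Wd G)) x y.
Proof.
move=> xV xd; rewrite W_treeE (negPf xd) !inE !(in_Wd xV)
  (@undirected_notin (Wa G)) ?(in_Wd xV) //
  (@undirected_notin (Wb G)) ?(in_Wd xV) //
  (@undirected_notin (Wc G)) ?(in_Wd xV) //.
by rewrite andbF /= ?orbF.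
Qed.

Lemma W_tree_root y : W_tree G d y ->
  [\/ y = a, y = b, y = c | undirected (hasse (Wd G)) d y].
Proof.
rewrite W_treeE !inE !diamondE andbF.
rewrite (@undirected_notin (Wa G)) ?diamondE // (@undirected_notin (Wb G)) ?diamondE //
  (@undirected_notin (Wc G)) ?diamondE //=.
case/orP=> [|/orP[/orP[]|] /eqP]; [by constructor 4 | by constructor 1 |
  by constructor 2 | by constructor 3].
Qed.

Lemma W_tree_stay V x p :
  (forall x y, x \in V -> x != d -> y != d -> W_tree G x y ->
     undirected (hasse V) x y) ->
  x \in V -> d \notin x :: p -> path (W_tree G) x p ->
  path (undirected (hasse V)) x p && (last x p \in V).
Proof.
move=> WV; elim: p x => //= y p IHp x xV; rewrite !inE !negb_or.
case/and3P=> dx dy dp /andP[xy yp].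
have xyV : undirected (hasse V) x y by apply: WV; rewrite // eq_sym.
rewrite xyV; have [_ yV] := undirected_mem xyV.
by apply: IHp; rewrite // inE negb_or dy.
Qed.

Variant branch_spec y p : Prop :=
  | BranchA q of p = a :: q & y \in Wa G
      & simple_path (undirected (hasse (Wa G))) a y q
  | BranchB q of p = b :: q & y \in Wb G
      & simple_path (undirected (hasse (Wb G))) b y q
  | BranchC q of p = c :: q & y \in Wc G
      & simple_path (undirected (hasse (Wc G))) c y q
  | BranchD of y \in Wd G & simple_path (undirected (hasse (Wd G))) d y p.

(** The pieces communicate only through [d], to which a simple path starting there never returns; so
    its first step decides the piece in which it remains. *)
Lemma branchP y p : simple_path (W_tree G) d y p -> branch_spec y p.
Proof.
case/and3P; case: p => [|x p] /=.
  move=> _ /eqP <- _; constructor 4; first exact: d_Wd.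
  by rewrite /simple_path /= eqxx.
case/andP=> dx xp /eqP yE /and3P[dNp xNp pu].
have build V v : (forall x y, x \in V -> x != d -> y != d -> W_tree G x y ->
     undirected (hasse V) x y) -> v \in V -> x = v ->
    y \in V /\ simple_path (undirected (hasse V)) v y p.
  move=> WV vV xE; rewrite -xE in vV *.
  have /andP[xpV lV] := W_tree_stay WV vV dNp xp.
  by rewrite /simple_path xpV yE eqxx /= xNp pu -yE lV.
case/W_tree_root: (dx) => [xE|xE|xE|dxV].
- have [|yV xpV] := build (Wa G) a _ a_Wa xE.
    by move=> u v uV _; apply: W_tree_Wa.
  by apply: (BranchA (q := p)); rewrite ?xE.
- have [|yV xpV] := build (Wb G) b _ b_Wb xE.
    by move=> u v uV _; apply: W_tree_Wb.
  by apply: (BranchB (q := p)); rewrite ?xE.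
- have [|yV xpV] := build (Wc G) c _ c_Wc xE.
    by move=> u v uV _; apply: W_tree_Wc.
  by apply: (BranchC (q := p)); rewrite ?xE.
- have [_ xV] := undirected_mem dxV.
  have [|yV /and3P[xpV _ _]] := build (Wd G) x _ xV erefl.
    by move=> u v uV ud _; apply: W_tree_Wd.
  by apply: BranchD => //; rewrite /simple_path /= dxV xpV yE eqxx dNp xNp pu.
Qed.

Lemma W_tree_sub V : V \in [:: Wa G; Wb G; Wc G; Wd G] ->
  subrel (undirected (hasse V)) (W_tree G).
Proof.
by rewrite !inE => /or4P[] /eqP -> x y xy; rewrite W_treeE xy ?orbT.
Qed.

Lemma W_tree_gate v : v \in [set a; b; c]%SET -> W_tree G d v.
Proof. by move=> vG; rewrite W_treeE eqxx vG !orbT. Qed.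

Lemma acyclic_uniq V x y p q : W_class V ->
  simple_path (undirected (hasse V)) x y p ->
  simple_path (undirected (hasse V)) x y q -> p = q.
Proof.
by case=> _ acy _ _ _; apply: (acyclic_simple_path_uniq (undirected_sym _) acy).
Qed.

(** The end point determines the branch of a simple path from [d], and within the branch uniqueness
    comes from acyclicity of a single piece. *)
Lemma W_tree_rooted : rooted_tree (W_tree G) d.
Proof.
have [Ka Kb Kc Kd] := wgd_W_class WG.
have conn V v z : V \in [:: Wa G; Wb G; Wc G; Wd G] -> W_class V ->
    v \in V -> z \in V -> connect (W_tree G) v z.
  move=> Vin [con _ _ _ _] vV zV; have := con v z vV zV.
  by apply: connect_sub => x y /(W_tree_sub Vin); apply: connect1.
split.
- exact: undirected_sym.
- move=> x; apply/negbTE/negP; rewrite W_treeE.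
  have und V : undirected (hasse V) x x = false.
    by rewrite /undirected orbb /hasse ltxx !andbF.
  rewrite !und /= orbb => /andP[/eqP ->]; by rewrite !inE !diamondE.
- move=> x; have gate v : v \in [set a; b; c]%SET -> connect (W_tree G) d v.
    by move/W_tree_gate; apply: connect1.
  case: (pieceP x) => xV.
  + apply: connect_trans (gate a _) (conn (Wa G) _ _ _ Ka a_Wa xV);
      by rewrite !inE ?eqxx ?orbT.
  + apply: connect_trans (gate b _) (conn (Wb G) _ _ _ Kb b_Wb xV);
      by rewrite !inE ?eqxx ?orbT.
  + apply: connect_trans (gate c _) (conn (Wc G) _ _ _ Kc c_Wc xV);
      by rewrite !inE ?eqxx ?orbT.
  + by apply: (conn (Wd G) _ _ _ Kd d_Wd xV); rewrite !inE eqxx ?orbT.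
- move=> x p q; case/branchP=> [p' -> xV xp|p' -> xV xp|p' -> xV xp|xV xp];
  case/branchP=> [q' -> xU xq|q' -> xU xq|q' -> xU xq|xU xq];
  try (by move: xU; rewrite ?(in_Wa xV) ?(in_Wb xV) ?(in_Wc xV) ?(in_Wd xV)).
  + by rewrite (acyclic_uniq Ka xp xq).
  + by rewrite (acyclic_uniq Kb xp xq).
  + by rewrite (acyclic_uniq Kc xp xq).
  + exact: acyclic_uniq Kd xp xq.
Qed.

(** * Subtrees of the glued tree and the cuts they define in [S] *)

Lemma path_undirected_in V x p : path (undirected (hasse V)) x p -> x \in V ->
  {subset x :: p <= V}.
Proof.
elim: p x => [|y p IHp] x /= => [_|/andP[/undirected_mem[_ yV] /IHp/(_ yV) yp]] xV z.
  by rewrite inE => /eqP ->.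
by rewrite inE => /predU1P[-> //|]; apply: yp.
Qed.

Let eT := W_tree_rooted.
Local Notation le := (tree_le (W_tree G) d).
Local Notation child := (child (W_tree G) d).

Lemma le_piece x y : y != d -> le x y ->
  [\/ x \in Wa G /\ y \in Wa G, x \in Wb G /\ y \in Wb G,
      x \in Wc G /\ y \in Wc G | x \in Wd G /\ y \in Wd G].
Proof.
move=> yd; rewrite (tree_leE eT) inE (negPf yd) /=.
case/branchP: (rpathP eT x) => [q ->|q ->|q ->|] xV /and3P[xq _ _] yq.
- by constructor 1; split=> //; apply: path_undirected_in yq; rewrite ?a_Wa.
- by constructor 2; split=> //; apply: path_undirected_in yq; rewrite ?b_Wb.
- by constructor 3; split=> //; apply: path_undirected_in yq; rewrite ?c_Wc.
- constructor 4; split=> //; apply: (path_undirected_in xq); rewrite ?d_Wd //.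
  by rewrite inE yq orbT.
Qed.

Lemma rpath_gate v : v \in [set a; b; c]%SET -> rpath eT v = [:: v].
Proof.
move=> vG; apply: rpathE; rewrite /simple_path /= W_tree_gate // eqxx.
by move: vG; rewrite !inE -!orbA => /or3P[] /eqP ->; rewrite !diamondE.
Qed.

Lemma child_gate x v : v \in [set a; b; c]%SET -> child x v -> x = d.
Proof.
move=> vG; rewrite (childE eT) rpath_gate // => /eqP xE.
have : rpath eT x = [::] by case: (rpath eT x) xE => [//|u [|w r]].
by rewrite -(rpath_root eT) => /rpath_inj.
Qed.

Lemma le_gate v y : v \in [set a; b; c]%SET -> y != d -> le v y -> v = y.
Proof.
by move=> vG yd; rewrite (tree_leE eT) rpath_gate // !inE (negPf yd) => /eqP.
Qed.

Lemma subtree_a : subtree (W_tree G) d a = Wa G.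
Proof.
apply/setP=> x; rewrite finset.in_set; apply/idP/idP => [|xV].
  by case/le_piece => [|[]|[]|[]|[]]; rewrite ?diamondE.
rewrite (tree_leE eT); case/branchP: (rpathP eT x) => [q ->|q _|q _|].
- by rewrite !inE eqxx orbT.
- by rewrite (in_Wa xV).
- by rewrite (in_Wa xV).
- by rewrite (in_Wa xV).
Qed.

Lemma subtree_b : subtree (W_tree G) d b = Wb G.
Proof.
apply/setP=> x; rewrite finset.in_set; apply/idP/idP => [|xV].
  by case/le_piece => [|[]|[]|[]|[]]; rewrite ?diamondE.
rewrite (tree_leE eT); case/branchP: (rpathP eT x) => [q _|q ->|q _|].
- by rewrite (in_Wb xV).
- by rewrite !inE eqxx orbT.
- by rewrite (in_Wb xV).
- by rewrite (in_Wb xV).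
Qed.

Lemma subtree_c : subtree (W_tree G) d c = Wc G.
Proof.
apply/setP=> x; rewrite finset.in_set; apply/idP/idP => [|xV].
  by case/le_piece => [|[]|[]|[]|[]]; rewrite ?diamondE.
rewrite (tree_leE eT); case/branchP: (rpathP eT x) => [q _|q _|q ->|].
- by rewrite (in_Wc xV).
- by rewrite (in_Wc xV).
- by rewrite !inE eqxx orbT.
- by rewrite (in_Wc xV).
Qed.

(* Away from the diamond, the only edge of the Hasse diagram of [S] that leaves
   a subtree is the one above its root. *)
Lemma subtree_cut x y : child x y -> y \notin diamond G ->
  let U := subtree (W_tree G) d y in
  [/\ {subset U <= ~: diamond G}%SET,
      (x < y)%O -> up_set U & (y < x)%O -> up_set (~: U)%SET].
Proof.
move=> xy yG U.
have [yd yv] : y != d /\ (forall v, v \in [set a; b; c]%SET -> v != y).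
  move: yG; rewrite !inE !negb_or -!andbA => /and4P[ya yb yc yd]; split=> // v.
  by rewrite !inE -!orbA => /or3P[] /eqP ->; rewrite eq_sym.
have yroot : ~~ le d y.
  by apply/negP => /(tree_le_anti eT (tree_le_root eT y))/eqP; rewrite (negPf yd).
have UG z : z \in U -> z \notin diamond G.
  rewrite finset.in_set => zy; apply/negP => zG.
  have [zE|zd] := eqVneq z d; first by rewrite zE (negPf yroot) in zy.
  have zG' : z \in [set a; b; c]%SET by move: zG; rewrite !inE (negPf zd) orbF.
  by have /eqP := le_gate zG' yd zy; rewrite (negPf (yv z zG')).
(* A cover of [S] that is not a tree edge has both ends in the diamond, so every cover that leaves
   [U] is a tree edge, namely the one between [y] and [x]. *)
have hasse_edge u w : u \notin diamond G \/ w \notin diamond G ->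
    hasse [set: S]%SET u w -> W_tree G u w.
  rewrite !inE => uw /coverP[uwV|uwV|uwV|uwV|uE wE|uE wE|uE wE|uE wE];
    try (by rewrite W_treeE /undirected uwV ?orbT);
    by case: uw; rewrite ?uE ?wE !eqxx ?orbT.
have leave u w : u \in U -> w \notin U -> W_tree G u w -> u = y /\ w = x.
  rewrite !finset.in_set => uU wU uw; have [uE wu] := edge_leaving eT uw uU wU.
  by split=> //; apply: (child_uniq eT) xy; rewrite -uE.
split=> [z /UG|xlty|yltx].
- by rewrite finset.in_setC.
- apply: up_set_hasse => u w uU uw; apply: contraT => wU.
  have [uE wE] := leave _ _ uU wU (hasse_edge _ _ (or_introl (UG _ uU)) uw).
  have [_ _] := hasse_mem uw.
  by rewrite uE wE => /(lt_trans xlty); rewrite ltxx.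
- apply: up_set_hasse => u w; rewrite !finset.in_setC => uU uw; apply/negP => wU.
  have := hasse_edge _ _ (or_intror (UG _ wU)) uw.
  rewrite (rt_sym eT) => wu; have [wE uE] := leave _ _ wU uU wu.
  have [_ _] := hasse_mem uw.
  by rewrite uE wE => /(lt_trans yltx); rewrite ltxx.
Qed.

(** * From distribution functions on the pieces to sums over the whole tree *)

Lemma sub_hasse D : D \in [:: hatWb G; hatWc G; Wprime G] ->
  subrel (undirected (hasse D)) (W_tree G).
Proof.
by rewrite !inE => /or3P[] /eqP -> x y; rewrite /W_tree /undirected /glued_hasse /=
  => /orP[] ->; rewrite ?orbT.
Qed.

Lemma connect_hat D V v : W_class V -> v \in V -> connect (undirected (hasse D)) d v ->
  (forall x y, hasse V x y -> hasse D x y) ->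
  forall z, z \in V -> connect (undirected (hasse D)) d z.
Proof.
move=> [con _ _ _ _] vV dv VD z zV; apply: connect_trans dv _.
have := con v z vV zV; apply: connect_sub => x y xy; apply: connect1.
by case/orP: xy => /VD xy; rewrite /undirected xy ?orbT.
Qed.

Lemma connect_hatWb z : z \in hatWb G -> connect (undirected (hasse (hatWb G))) d z.
Proof.
have [_ Kb _ _] := wgd_W_class WG; rewrite !inE => /predU1P[->|zV]; first exact: connect0.
apply: (connect_hat Kb b_Wb) zV; last by move=> x y xy; rewrite hatWb_hasse xy.
by apply: connect1; rewrite /undirected !hatWb_hasse !eqxx !orbT.
Qed.

Lemma connect_hatWc z : z \in hatWc G -> connect (undirected (hasse (hatWc G))) d z.
Proof.
have [_ _ Kc _] := wgd_W_class WG; rewrite !inE => /predU1P[->|zV]; first exact: connect0.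
apply: (connect_hat Kc c_Wc) zV; last by move=> x y xy; rewrite hatWc_hasse xy.
by apply: connect1; rewrite /undirected !hatWc_hasse !eqxx !orbT.
Qed.

Lemma connect_Wprime z : z \in Wprime G -> connect (undirected (hasse (Wprime G))) d z.
Proof.
have [Ka _ _ Kd] := wgd_W_class WG; rewrite finset.in_setU => /orP[] zV.
  apply: (connect_hat Ka a_Wa) zV; last by move=> x y xy; rewrite Wprime_hasse xy.
  by apply: connect1; rewrite /undirected !Wprime_hasse !eqxx !orbT.
apply: (connect_hat Kd d_Wd) zV; first exact: connect0.
by move=> x y xy; rewrite Wprime_hasse xy orbT.
Qed.

(** Only masses below [x] enter, so [Q] may differ from [Q'] elsewhere, in particular at the root
    [d], where the masses of the pieces are adjusted. *)
Lemma distribution_functionE (R : realType) D (Q Q' : S -> R) x :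
  D \in [:: hatWb G; hatWc G; Wprime G] ->
  (forall z, z \in D -> connect (undirected (hasse D)) d z) ->
  (forall z, le z x -> z \in D /\ Q z = Q' z) ->
  distribution_function D d Q x = \sum_(z | le z x) Q' z.
Proof.
move=> Din Dcon QQ'; have [xD _] := QQ' x (tree_le_refl eT x).
apply: eq_big => [z|z /andP[zD zx]].
  have [zD|zD] /= := boolP (z \in D).
    exact: (tree_le_subrel eT (sub_hasse Din) (Dcon _ zD) (Dcon _ xD)).
  by apply/esym/negP => /QQ'[]; rewrite (negPf zD).
apply QQ'; rewrite -(tree_le_subrel eT (sub_hasse Din) (Dcon _ zD) (Dcon _ xD)).
exact: zx.
Qed.

(** * Mass inequalities and the comparison of [F1] with [F2] along tree edges *)

Section DistributionFunctions.
Variables (R : realType) (P1 P2 : S -> R).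
Hypotheses (P1_ge0 : forall x, 0 <= P1 x) (P2_ge0 : forall x, 0 <= P2 x).
Hypothesis (P12 : stoch_le P1 P2).

Definition excess_b : R := q' G P1 P2 - mass P1 (Wb G).
Definition excess_c : R := q'' G P1 P2 - mass P1 (Wc G).

(* The measure whose distribution function on the tree is [F1]: compared with
   [P1], it moves mass from [a] to [b] and [c]. *)
Definition P1_tree z : R :=
  P1 z + excess_b * ((z == b)%:R - (z == a)%:R)
       + excess_c * ((z == c)%:R - (z == a)%:R).

Lemma mass_P1_tree (A : {set S}) : mass P1_tree A = mass P1 A +
  excess_b * ((b \in A)%:R - (a \in A)%:R) +
  excess_c * ((c \in A)%:R - (a \in A)%:R).
Proof.
have one v : \sum_(z in A) (z == v)%:R = (v \in A)%:R :> R.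
  have [vA|vA] := boolP (v \in A).
    rewrite (bigD1 v) //= eqxx big1 ?addr0 // => z /andP[_ /negPf -> //].
  by rewrite big1 // => z zA; case: eqP => // zE; rewrite -zE zA in vA.
rewrite /mass /P1_tree !big_split /= -!mulr_sumr !sumrB !one.
by [].
Qed.

Lemma massU (P : S -> R) (A B : {set S}) : [disjoint A & B] ->
  mass P (A :|: B)%SET = mass P A + mass P B.
Proof.
by move=> AB; rewrite /mass -bigU //; apply: eq_bigl => x; rewrite !inE.
Qed.

Lemma mass_set1 (P : S -> R) v : mass P [set v]%SET = P v.
Proof. by rewrite /mass big_set1. Qed.

Lemma mass_down_le (A : {set S}) : up_set (~: A)%SET -> mass P2 A <= mass P1 A.
Proof.
case: P12 => PT Pup /Pup.
have massC (P : S -> R) : mass P [set: S]%SET = mass P A + mass P (~: A)%SET.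
  by rewrite -massU ?finset.setUCr // -setI_eq0 finset.setICr.
by move: PT; rewrite !massC => PT Ple; lra.
Qed.

(** Where a maximum is attained by [P1], its term cancels; where it is attained by [P2], the
    corresponding piece joins [A]. Each of the four cases is the inequality for one down-set of
    [low_up_sets]. *)
Lemma low_mass_le (A : {set S}) : A = [set a]%SET \/ A = Wa G ->
  mass P2 A + q' G P1 P2 + q'' G P1 P2 <=
  mass P1 A + mass P1 (Wb G) + mass P1 (Wc G).
Proof.
move=> AE; have [U0 Ub Uc Ubc] := low_up_sets AE.
have [[ab ac _] [bc _ _]] := wgd_disjoint WG.
have Ab : [disjoint A & Wb G] by case: AE => ->; rewrite ?disjoints1 ?diamondE.
have Ac : [disjoint A & Wc G] by case: AE => ->; rewrite ?disjoints1 ?diamondE.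
have Abc : [disjoint A & Wb G :|: Wc G].
  rewrite disjoint_sym (eq_disjoint (B := predU (mem (Wb G)) (mem (Wc G)))).
    by rewrite disjointU !(disjoint_sym _ A) Ab Ac.
  by move=> x; rewrite !inE.
move: (mass_down_le U0) (mass_down_le Ub) (mass_down_le Uc) (mass_down_le Ubc).
rewrite !(massU _ Ab) !(massU _ Ac) !(massU _ Abc) !(massU _ bc).
rewrite /q' /q'' !maxEle; case: ifP => _; case: ifP => _; lra.
Qed.

Lemma excess_b_ge0 : 0 <= excess_b.
Proof. by rewrite subr_ge0 le_max lexx. Qed.

Lemma excess_c_ge0 : 0 <= excess_c.
Proof. by rewrite subr_ge0 le_max lexx. Qed.

(** Only [a] loses mass, and [low_mass_le] for [[set a]] leaves at least [P2 a] there. *)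
Lemma P1_tree_ge0 z : 0 <= P1_tree z.
Proof.
have := low_mass_le (or_introl erefl); rewrite !mass_set1.
move: (P1_ge0 z) (P2_ge0 a) excess_b_ge0 excess_c_ge0.
rewrite /P1_tree /excess_b /excess_c.
have [->|za] := eqVneq z a; rewrite ?diamondE /=; first by lra.
have [->|zb] := eqVneq z b; rewrite ?diamondE /=; first by lra.
by have [->|zc] := eqVneq z c; rewrite ?diamondE /=; lra.
Qed.

Lemma mass_setD1 (P : S -> R) (A : {set S}) v : v \in A ->
  mass P A = P v + mass P (A :\ v)%SET.
Proof. by move=> vA; rewrite /mass (finset.big_setD1 v). Qed.

Lemma in_Wprime x : (x \in Wprime G) = (x \in Wa G) || (x \in Wd G).
Proof. exact: finset.in_setU. Qed.

(** The modified masses are those of [P1_tree]: at [b], [q' - P1(Wb :\ b) = P1 b + excess_b],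
    similarly at [c], and at [a] the two excesses are subtracted. At [d] the transport does not
    change the total. *)
Lemma F1_tree x : F1 G P1 P2 x = \sum_(z | le z x) P1_tree z.
Proof.
rewrite /F1; have [->|xd] := eqVneq x d.
  transitivity (mass P1_tree [set: S]%SET).
    by rewrite mass_P1_tree !inE; lra.
  by apply: eq_bigl => z; rewrite inE tree_le_root.
case: (pieceP x) => xV.
- rewrite !(in_Wa xV); apply: distribution_functionE.
  + by rewrite !inE eqxx !orbT.
  + exact: connect_Wprime.
  move=> z zx; case/(le_piece xd): (zx) => -[zV]; rewrite ?(in_Wa xV) // => _.
  rewrite in_Wprime zV; split=> //; rewrite /Pprime1 /P1_tree !(in_Wa zV).
  case: eqP => [->|_]; last by rewrite /=; lra.
  have [[ab ac _] [bc _ _]] := wgd_disjoint WG.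
  rewrite massU ?(massU _ bc) ?disjoints1 ?inE ?diamondE //.
  by rewrite mass_set1 /excess_b /excess_c /=; lra.
- rewrite xV; apply: distribution_functionE.
  + by rewrite !inE eqxx.
  + exact: connect_hatWb.
  move=> z zx; case/(le_piece xd): (zx) => -[zV]; rewrite ?(in_Wb xV) // => _.
  rewrite !inE zV orbT; split=> //; rewrite /Qeta1 /P1_tree !(in_Wb zV).
  case: eqP => [->|_]; last by rewrite /=; lra.
  by rewrite /excess_b (mass_setD1 _ b_Wb) /=; lra.
- rewrite !(in_Wc xV) xV; apply: distribution_functionE.
  + by rewrite !inE eqxx !orbT.
  + exact: connect_hatWc.
  move=> z zx; case/(le_piece xd): (zx) => -[zV]; rewrite ?(in_Wc xV) // => _.
  rewrite !inE zV orbT; split=> //; rewrite /Qeta1 /P1_tree !(in_Wc zV).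
  case: eqP => [->|_]; last by rewrite /=; lra.
  by rewrite /excess_c (mass_setD1 _ c_Wc) /=; lra.
- rewrite !(in_Wd xV); apply: distribution_functionE.
  + by rewrite !inE eqxx !orbT.
  + exact: connect_Wprime.
  move=> z zx; case/(le_piece xd): (zx) => -[zV]; rewrite ?(in_Wd xV) // => _.
  rewrite in_Wprime zV orbT; split=> //; rewrite /Pprime1 /P1_tree !(in_Wd zV) /=.
  by lra.
Qed.

Lemma F2_tree x : F2 G P1 P2 x = \sum_(z | le z x) P2 z.
Proof.
rewrite /F2; have [->|xd] := eqVneq x d.
  by apply: eq_bigl => z; rewrite inE tree_le_root.
have zd z : le z x -> z != d.
  move=> zx; apply: contraNneq xd => zE; rewrite zE in zx.
  by apply/eqP/(tree_le_anti eT) => //; apply: tree_le_root.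
case: (pieceP x) => xV; rewrite ?xV ?(in_Wa xV) ?(in_Wb xV) ?(in_Wc xV) ?(in_Wd xV);
  apply: distribution_functionE; rewrite ?inE ?eqxx ?orbT //;
  try (by [exact: connect_hatWb | exact: connect_hatWc | exact: connect_Wprime]);
  move=> z zx; case/(le_piece xd): (zx) => -[zV];
  rewrite ?(in_Wa xV) ?(in_Wb xV) ?(in_Wc xV) ?(in_Wd xV) // => _;
  by rewrite ?in_Wprime ?inE ?zV ?orbT /Qeta2 /Pprime2 (negPf (zd z zx)).
Qed.

Lemma F1E_mass x : F1 G P1 P2 x = mass P1_tree (subtree (W_tree G) d x).
Proof. by rewrite F1_tree; apply: eq_bigl => z; rewrite finset.in_set. Qed.

Lemma F2E_mass x : F2 G P1 P2 x = mass P2 (subtree (W_tree G) d x).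
Proof. by rewrite F2_tree; apply: eq_bigl => z; rewrite finset.in_set. Qed.

(** Off the diamond the subtree of [y] avoids [a], [b], [c], so [P1_tree] has the same mass on it as
    [P1] and the cut decides. On the three edges at [d], [F1] equals [q'] at [b] and [q''] at [c],
    while [a] is handled by [low_mass_le] for [Wa]. *)
Lemma F_child_cmp x y : child x y ->
  (x < y)%O /\ F1 G P1 P2 y <= F2 G P1 P2 y \/
  (y < x)%O /\ F2 G P1 P2 y <= F1 G P1 P2 y.
Proof.
move=> xy; rewrite F1E_mass F2E_mass.
have [yG|yG] := boolP (y \in diamond G); last first.
  have [Usub up down] := subtree_cut xy yG.
  have N v : v \in diamond G -> v \in subtree (W_tree G) d y = false.
    by move=> vG; apply/negP => /Usub; rewrite finset.in_setC vG.
  rewrite mass_P1_tree !N ?inE ?eqxx ?orbT // !subrr !mulr0 !addr0.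
  have : W_tree G x y by case/andP: xy.
  have lt_up : W_tree G x y -> (x < y)%O || (y < x)%O.
    case/orP=> /hasP[D _ /hasse_mem[_ _ ->]] //; by rewrite orbT.
  case/lt_up/orP => xlty; [left | right]; split=> //.
    by case: P12 => _; apply; apply: up.
  exact/mass_down_le/down.
have yNd : y != d by apply/eqP => yE; move: xy; rewrite yE (negPf (child_root eT x)).
have yG' : y \in [set a; b; c]%SET by move: yG; rewrite !inE (negPf yNd) orbF.
rewrite (child_gate yG' xy); right.
move: yG'; rewrite !inE -!orbA => /or3P[] /eqP ->; split;
  rewrite ?a_lt_d ?b_lt_d ?c_lt_d //.
- rewrite subtree_a mass_P1_tree !diamondE.
  by have := low_mass_le (or_intror erefl); rewrite /excess_b /excess_c /=; lra.
- rewrite subtree_b mass_P1_tree !diamondE.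
  have : mass P2 (Wb G) <= q' G P1 P2 by rewrite le_max lexx orbT.
  by rewrite /excess_b /=; lra.
- rewrite subtree_c mass_P1_tree !diamondE.
  have : mass P2 (Wc G) <= q'' G P1 P2 by rewrite le_max lexx orbT.
  by rewrite /excess_c /=; lra.
Qed.

End DistributionFunctions.

End WGluedDiamondTheory.

(** * Laws of level sets and construction of the modification *)

Lemma step_level_set (R : realType) (T : finType) (p : R) (Y : R -> T) x0 s
    (B : {set T}) :
  nonneg_steps s -> step_length s = p ->
  (forall w, 0 <= w < p -> Y w = step_fun x0 s w) ->
  measurable (level_set p Y B) /\
  lebesgue_measure (level_set p Y B) = (step_sum s (fun x => (x \in B)%:R))%:E.
Proof.
move=> s0 sp Ys; have := step_fun_law x0 B 0 s0; rewrite /= add0r sp.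
suff <- : level_set p Y B =
    [set w : R | 0 <= w < p /\ step_fun x0 s (w - 0) \in B]%classic by [].
by apply/seteqP; split=> w [wp]; rewrite /level_set /= subr0 Ys.
Qed.

Lemma sum_indicator (R : realType) (disp : Order.disp_t) (S : finPOrderType disp)
    (P : S -> R) (B : {set S}) :
  \sum_z P z * (z \in B)%:R = mass P B.
Proof.
rewrite /mass [RHS]big_mkcond; apply: eq_bigr => z _.
by case: (z \in B); rewrite /= ?mulr1 ?mulr0.
Qed.

Theorem proposition3p19 (disp : Order.disp_t) (S : finPOrderType disp)
    (R : realType) (G : glue_data S) (P1 P2 : S -> R) (p : R)
    (K : index_data S) (mu : K -> R) (X1 X2 : R -> S) :
  W_glued_diamond G ->
  (forall x, 0 <= P1 x) -> (forall x, 0 <= P2 x) ->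
  mass P1 [set: S]%SET = p -> mass P2 [set: S]%SET = p ->
  stoch_le P1 P2 ->
  index_tree K (W_tree G) (gd G) ->
  root_order G K ->
  is_distribution mu ->
  interlaced (gd G) mu (F1 G P1 P2) ->
  interlaced (gd G) mu (F2 G P1 P2) ->
  X1 = inverse_transform (W_tree G) (gd G) mu (F1 G P1 P2) ->
  X2 = inverse_transform (W_tree G) (gd G) mu (F2 G P1 P2) ->
  exists Y1 Y2 : R -> S,
    [/\ modification G p X1 X2 Y1 Y2,
        forall B : {set S},
          lebesgue_measure (level_set p Y1 B) = (mass P1 B)%:E,
        forall B : {set S},
          lebesgue_measure (level_set p Y2 B) = (mass P2 B)%:E
      & forall omega : R, 0 <= omega < p -> (Y1 omega <= Y2 omega)%O].
Proof.
move=> WG P1_ge0 P2_ge0 P1p P2p P12 KT _ muD mu1 mu2 X1E X2E.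
have eT := W_tree_rooted WG.
have F1p : F1 G P1 P2 (gd G) = p by rewrite /F1 eqxx.
have F2p : F2 G P1 P2 (gd G) = p by rewrite /F2 eqxx.
have mup : mu (iroot K) = p by case: mu1 => ->.
have F1t := F1_tree WG P1 P2; have F2t := F2_tree WG P1 P2.
have P1t := P1_tree_ge0 WG P1_ge0 P2_ge0 P12.
have [s1 [nn1 len1 X1s sum1]] := inverse_transform_steps eT KT F1t P1t mu1.
have [s2 [nn2 len2 X2s sum2]] := inverse_transform_steps eT KT F2t P2_ge0 mu2.
rewrite -X1E F1p in X1s len1; rewrite -X2E F2p in X2s len2.
have le12 w : 0 <= w < p -> (X1 w <= X2 w)%O.
  case/andP=> _ wp; rewrite X1E X2E.
  apply: (inverse_transform_le eT KT F1t F2t) => //; last by rewrite mup.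
  exact: (F_child_cmp WG P12).
have [ab ac cb] : [/\ ga G == gb G = false, ga G == gc G = false
    & gb G == gc G = false].
  by rewrite !(in_Wa WG (a_Wa WG)) !(in_Wb WG (b_Wb WG)).
have sum_pred1 v : \sum_z P1_tree G P1 P2 z * (z == v)%:R = P1_tree G P1 P2 v.
  rewrite (bigD1 v) //= eqxx mulr1 big1 ?addr0 // => z /negPf ->.
  by rewrite mulr0.
(* There is enough to move back: the steps with value [b] have total length [P1 b + excess_b]. *)
have [|t1 [nnt1 lent1 sumt1 t1s]] :=
    step_fun_replace (gd G) (v := gb G) (ga G) (m := excess_b G P1 P2) nn1.
  rewrite excess_b_ge0 sum1 sum_pred1 /P1_tree eqxx cb [gb G == ga G]eq_sym ab.
  by have := P1_ge0 (gb G); rewrite /=; lra.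
(* The first replacement leaves the total length of the steps with value [c] unchanged, since [c]
   differs from [a] and [b]. *)
have [|t2 [nnt2 lent2 sumt2 t2s]] :=
    step_fun_replace (gd G) (v := gc G) (ga G) (m := excess_c G P1 P2) nnt1.
  rewrite excess_c_ge0 sumt1 sum1 sum_pred1 /P1_tree eqxx cb ac.
  rewrite [gc G == gb G]eq_sym cb [gc G == ga G]eq_sym ac.
  by have := P1_ge0 (gc G); rewrite /=; lra.
pose Y1 := step_fun (gd G) t2.
have Y1X1 w : 0 <= w < p ->
    Y1 w = X1 w \/ X1 w \in [set gb G; gc G]%SET /\ Y1 w = ga G.
  move=> wp; rewrite /Y1 X1s // !inE.
  case: (t2s w) (t1s w) => [->|[t1c ->]] [t1w|[s1b t1a]].
  - by left.
  - by right; rewrite s1b eqxx.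
  - by right; rewrite -t1w t1c eqxx orbT.
  - by move: ac; rewrite -t1c t1a eqxx.
have Y1law B := step_level_set B nnt2 (etrans lent2 (etrans lent1 len1))
  (fun w _ => erefl (Y1 w)).
have X1law B := step_level_set B nn1 len1 X1s.
have X2law B := step_level_set B nn2 len2 X2s.
exists Y1, X2; split.
- split=> //.
  (* The exceptional set is described by values of both functions, so it is measurable as an
     intersection of two level sets. *)
  exists (level_set p Y1 [set ga G]%SET `&` level_set p X1 [set gb G; gc G]%SET)%classic.
  split.
  + by apply: measurableI; [have [] := Y1law [set ga G]%SET
                           |have [] := X1law [set gb G; gc G]%SET].
  + exact: subIsetr.
  + move=> w wp; case: ifPn => [|wN].
      by rewrite in_setE => -[[_]]; rewrite inE => /eqP.
    case: (Y1X1 w wp) => // -[X1w Y1w]; case/negP: wN.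
    by rewrite in_setE; split; split; rewrite // inE Y1w.
(* The two replacements cancel the two transports in [P1_tree]. *)
- move=> B; have [_ ->] := Y1law B; congr (_%:E).
  rewrite sumt2 sumt1 sum1 sum_indicator mass_P1_tree; lra.
- by move=> B; have [_ ->] := X2law B; rewrite sum2 sum_indicator.
- move=> w wp; have := le12 w wp.
  case: (Y1X1 w wp) => [-> //|[X1w ->]]; apply: le_trans.
  by move: X1w; rewrite !inE => /orP[] /eqP ->; apply: ltW;
    [apply: a_lt_b | apply: a_lt_c].
Qed.
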